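(* Let $F \in \mathcal{G}$. The symmetry group $\mathcal{S}_{\mathcal{G}}(F)$ is (up to isomorphism of groups in (2)–(4)): (1) $\mathcal{G}$ if and only if $F = \mathrm{Id}$; (2) $C_2 \times C_2$ if and only if $F^2 = \mathrm{Id} \neq F$; (3) $C_3$ if and only if $F^3 = \mathrm{Id} \neq F$; (4) $C_\infty$ in all remaining cases, i.e. whenever $F$ is not of finite order.
   Context: Let $I(x,y,z) = x^2+y^2+z^2-2xyz-1$ (the Fricke–Vogt invariant). Let $$\mathcal{G} = \{F \in \mathbb{Z}[x,y,z]^3 \mid I(F(x,y,z)) = I(x,y,z) \text{ and } F(1,1,1) = (1,1,1)\},$$ the set of Nielsen trace maps, viewed as polynomial mappings of 3-space. It is known that $\mathcal{G}$ is a group under composition and that $\mathcal{G} \simeq PGl(2,\mathbb{Z}) \simeq Gl(2,\mathbb{Z})/\{\pm \mathbf{1}\}$. $\mathrm{Id}$ denotes the identity mapping and $F^n$ the $n$-fold composition. For $F \in \mathcal{G}$, the symmetry group of $F$ within $\mathcal{G}$ is $\mathcal{S}_{\mathcal{G}}(F) = \{S \in \mathcal{G} \mid F \circ S = S \circ F\}$. $C_n$ is the cyclic group of order $n$, and $C_\infty \simeq \mathbb{Z}$ is the infinite cyclic group. *)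

(* Defs.v *)
From HB Require Import structures.
From mathcomp Require Import all_boot all_order all_algebra.
From mathcomp Require Import mpoly.

Set Implicit Arguments.
Unset Strict Implicit.
Unset Printing Implicit Defensive.

Import GRing.Theory.
Local Open Scope ring_scope.

(* Since Z is infinite, a polynomial mapping of 3-space is determined by, and
   identified with, its triple of component polynomials. *)
Definition polymap : Type := 3.-tuple {mpoly int[3]}.

Definition fricke_vogt : {mpoly int[3]} :=
  'X_0 ^+ 2 + 'X_1 ^+ 2 + 'X_2 ^+ 2 - 2 * 'X_0 * 'X_1 * 'X_2 - 1.

Definition pm_id : polymap := [tuple 'X_i | i < 3].

(* F after G: substitute the components of G into those of F. *)
Definition pm_comp (F G : polymap) : polymap :=
  [tuple tnth F i \mPo G | i < 3].

Definition pm_iter (n : nat) (F : polymap) : polymap :=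
  iter n (pm_comp F) pm_id.

Definition nielsen : {pred polymap} :=
  [pred F : polymap | (fricke_vogt \mPo F == fricke_vogt)
                      && [forall i : 'I_3, (tnth F i).@[fun=> 1] == 1]].

Definition symmetry (F : polymap) : {pred polymap} :=
  [pred S : polymap | (S \in nielsen) && (pm_comp F S == pm_comp S F)].

Definition finite_order (F : polymap) : Prop :=
  exists n : nat, (0 < n)%N /\ pm_iter n F = pm_id.

(* The set P, with composition, is isomorphic to the abelian group A: the
   group law of A is written additively, and phi is a bijection from A onto P
   turning addition into composition (so P is then a group). *)
Definition pm_isog (P : {pred polymap}) (A : zmodType) : Prop :=
  exists phi : A -> polymap,
    [/\ injective phi,
        forall S : polymap, S \in P <-> exists a : A, phi a = S
      & forall a b : A, phi (a + b) = pm_comp (phi a) (phi b)].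

(* Main.v *)
(* The gradients at the singular point (1,1,1) of I of the components of a trace map F
   are squares of linear forms v1, v2, v1 + v2, where v1, v2 are the rows of a matrix in
   GL(2,Z) defined up to sign.  This gives a homomorphism to PGL(2,Z).  It is bijective
   by descent: among the degrees of the components (f,g,h) the largest is the sum of the
   other two unless F permutes the coordinates, and the Vieta move h -> 2fg - h then lowers
   it.  The centralizer of A in PGL(2,Z) comes from the quadratic order Z[A]: for trace 0 it
   is generated by A and an anticommuting matrix; otherwise it is the unit group of an
   order modulo sign, finite for discriminant -3, and infinite cyclic for nonnegative
   discriminant because trace plus irrational part strictly increases under products of
   positive units. *)
Require Import Defs.
From HB Require Import structures.
From mathcomp Require Import all_boot all_order all_algebra.
From mathcomp Require Import mpoly.
From mathcomp Require Import ring lra zify.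

Set Implicit Arguments.
Unset Strict Implicit.
Unset Printing Implicit Defensive.

Import Order.TTheory GRing.Theory Num.Theory.
Local Open Scope ring_scope.

(** * Composition of polynomial maps *)

(** With x = 1 + u, y = 1 + v, z = 1 + w the invariant becomes u^2 + v^2 + w^2 - 2uv - 2vw - 2uw -
    2uvw. Its quadratic part cuts out the cone parametrized, up to sign, by (s^2, t^2, (s + t)^2),
    which the linear part of a trace map preserves: this is the origin of the squares of v1, v2, v1
    + v2. Since f = g = 1 at the point, the Vieta move acts linearly on gradients, as the
    parallelogram law exchanging v1 + v2 and v1 - v2. The same move therefore lowers degrees,
    produces the matrix of a given map and realizes a given matrix. Two obstacles shape the
    argument. Degree descent alone does not show that a map with identity Jacobian is the identity,
    so a positive definite weight of the gradients is carried along. And Nielsen maps are not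
    assumed invertible: inverses come from realizing inverse matrices. The classification is turned
    into equivalences at the end, because F lies in its own symmetry group, whose isomorphism type
    then reveals the order of F. *)

Lemma mpoly_ring_ind (R : comNzRingType) n (P : {mpoly R[n]} -> Prop) :
    (forall c, P c%:MP) -> (forall i, P 'X_i) ->
    (forall p q, P p -> P q -> P (p + q)) ->
    (forall p q, P p -> P q -> P (p * q)) ->
  forall p, P p.
Proof.
move=> PC PX PD PM p; rewrite [p]mpolyE.
apply: big_ind => [||m _]; [exact: (PC 0)|by []|].
rewrite -mul_mpolyC; apply/PM; first exact: PC.
rewrite mpolyXE_id; apply: big_ind => [||i _]; [exact: (PC 1)|by []|].
elim: (m i) => [|k IH]; first exact: (PC 1).
by rewrite exprS; apply: PM.
Qed.

Section Composition.
Context (R : comNzRingType).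

Lemma comp_mpolyA k l n (p : {mpoly R[n]}) (G : n.-tuple {mpoly R[k]})
    (H : k.-tuple {mpoly R[l]}) :
  (p \mPo G) \mPo H = p \mPo [tuple tnth G i \mPo H | i < n].
Proof.
elim/mpoly_ring_ind: p => [c|i|p q|p q]; rewrite ?comp_mpolyC //.
- by rewrite !comp_mpolyXU -!tnth_nth tnth_mktuple.
- by rewrite !comp_mpolyD => -> ->.
- by rewrite !rmorphM /= => -> ->.
Qed.

Lemma mderivXU n (i j : 'I_n) : 'X_i^`M(j) = (i == j)%:R :> {mpoly R[n]}.
Proof.
rewrite mderivX mnm1E; case: eqP => [->|_]; last by rewrite scale0r.
by rewrite scale1r -[RHS]mpolyX0; congr 'X_[_]; apply/mnmP=> l; rewrite mnmBE subnn mnm0E.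
Qed.

Lemma mderiv_comp n k (p : {mpoly R[n]}) (G : n.-tuple {mpoly R[k]}) j :
  (p \mPo G)^`M(j) = \sum_i (p^`M(i) \mPo G) * (tnth G i)^`M(j).
Proof.
elim/mpoly_ring_ind: p => [c|i|p q Hp Hq|p q Hp Hq].
- rewrite comp_mpolyC mderivC big1 // => i _.
  by rewrite mderivC comp_mpoly0 mul0r.
- rewrite comp_mpolyXU -tnth_nth (bigD1 i) //= mderivXU eqxx rmorph1 mul1r.
  rewrite big1 ?addr0 // => l /negPf nli.
  by rewrite mderivXU eq_sym nli rmorph0 mul0r.
- rewrite comp_mpolyD mderivD Hp Hq -big_split; apply: eq_bigr => i _.
  by rewrite mderivD comp_mpolyD mulrDl.
- rewrite rmorphM mderivM Hp Hq big_distrl big_distrr -big_split.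
  by apply: eq_bigr => i _; rewrite mderivM /= rmorphD !rmorphM /=; ring.
Qed.
End Composition.

Lemma ord3P (P : 'I_3 -> Prop) : P 0 -> P 1 -> P 2 -> forall i, P i.
Proof.
move=> P0 P1 P2 [[|[|[|//]]] lt3].
- by rewrite (_ : Ordinal _ = 0) //; apply: val_inj.
- by rewrite (_ : Ordinal _ = 1) //; apply: val_inj.
- by rewrite (_ : Ordinal _ = 2) //; apply: val_inj.
Qed.

Definition triple (f g h : {mpoly int[3]}) : polymap := [tuple f; g; h].

Lemma tripleE (F : polymap) : F = triple (tnth F 0) (tnth F 1) (tnth F 2).
Proof.
by apply: eq_from_tnth; apply: ord3P; rewrite [RHS](tnth_nth 0).
Qed.

Lemma pm_idE : pm_id = triple 'X_0 'X_1 'X_2.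
Proof. by rewrite [LHS]tripleE !tnth_mktuple. Qed.

Lemma pm_compA F G H : pm_comp F (pm_comp G H) = pm_comp (pm_comp F G) H.
Proof.
by apply: eq_from_tnth => i; rewrite !tnth_mktuple comp_mpolyA.
Qed.

Lemma pm_comp_id F : pm_comp F pm_id = F.
Proof. by apply: eq_from_tnth => i; rewrite !tnth_mktuple comp_mpoly_id. Qed.

Lemma pm_id_comp F : pm_comp pm_id F = F.
Proof.
by apply: eq_from_tnth => i; rewrite !tnth_mktuple comp_mpolyXU -tnth_nth.
Qed.

(** Stated over any ring, so that it applies both to polynomials and to their integer values. *)
Definition fricke (R : pzRingType) (x y z : R) : R :=
  x ^+ 2 + y ^+ 2 + z ^+ 2 - 2 * x * y * z - 1.

Lemma fricke_vogt_comp f g h :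
  fricke_vogt \mPo (triple f g h) = fricke f g h.
Proof.
by rewrite /fricke_vogt !(rmorphB, rmorphD, rmorphM, rmorphXn, rmorph1, rmorph_nat) /=
   !comp_mpolyXU.
Qed.

Definition at1 (p : {mpoly int[3]}) : int := p.@[fun=> 1].
Definition is_trace_map (f g h : {mpoly int[3]}) :=
  [/\ fricke f g h = fricke_vogt, at1 f = 1, at1 g = 1 & at1 h = 1].

Lemma nielsenP f g h : reflect (is_trace_map f g h) (triple f g h \in nielsen).
Proof.
rewrite inE fricke_vogt_comp; apply: (iffP andP).
  move=> [/eqP e /forallP H]; split=> //; apply/eqP.
  - exact: (H 0).
  - exact: (H 1).
  - exact: (H 2).
move=> [-> f1 g1 h1]; split=> //; apply/forallP.
by apply: ord3P; rewrite (tnth_nth 0) /=; apply/eqP.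
Qed.

Lemma nielsen_at1 F i : F \in nielsen -> at1 (tnth F i) = 1.
Proof. by case/andP => _ /forallP/(_ i)/eqP. Qed.

Lemma nielsen_id : pm_id \in nielsen.
Proof.
by rewrite pm_idE; apply/nielsenP; split; rewrite // /at1 mevalXU.
Qed.

Lemma nielsen_comp F G : F \in nielsen -> G \in nielsen -> pm_comp F G \in nielsen.
Proof.
move=> /andP[/eqP FI /forallP F1] GN; apply/andP; split.
  rewrite /= -comp_mpolyA FI; by case/andP: GN.
apply/forallP => i; rewrite tnth_mktuple comp_mpoly_meval.
rewrite (meval_eq _ (v2 := fun=> 1)) //.
by move=> j; apply: nielsen_at1.
Qed.

Definition jac (F : polymap) : 'M[int]_3 :=
  \matrix_(i, j) at1 (tnth F i)^`M(j).

(** The chain rule; since G fixes (1,1,1), both Jacobians are taken at the same point. *)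
Lemma jac_comp F G : G \in nielsen -> jac (pm_comp F G) = jac F *m jac G.
Proof.
move=> GN; apply/matrixP => i j; rewrite !mxE tnth_mktuple mderiv_comp.
rewrite /at1 raddf_sum; apply: eq_bigr => k _; rewrite /= mevalM !mxE.
congr (_ * _); rewrite comp_mpoly_meval; apply: meval_eq => l.
exact: nielsen_at1.
Qed.

(** * Trace maps of degree one *)

Definition is_perm_coords (f g h : {mpoly int[3]}) : bool :=
  perm_eq [:: f; g; h] [:: 'X_0; 'X_1; 'X_2].

Lemma is_perm_coords_swap f g h : is_perm_coords f g h = is_perm_coords g f h.
Proof. exact: (permPl (permEl (perm_catCA [:: f] [:: g] [:: h]))). Qed.

Lemma is_perm_coords_swapr f g h : is_perm_coords f g h = is_perm_coords f h g.
Proof.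
have H : perm_eq [:: f; g; h] [:: f; h; g].
  by rewrite perm_cons; apply/permEl/(perm_catC [:: g] [:: h]).
by rewrite /is_perm_coords (permPl H).
Qed.

Lemma is_trace_map_swap f g h : is_trace_map f g h -> is_trace_map g f h.
Proof. by case=> e f1 g1 h1; split=> //; rewrite -e /fricke; ring. Qed.

Lemma is_trace_map_swapr f g h : is_trace_map f g h -> is_trace_map f h g.
Proof. by case=> e f1 g1 h1; split=> //; rewrite -e /fricke; ring. Qed.

Lemma is_trace_map_vieta f g h :
  is_trace_map f g h -> is_trace_map f g (2 * f * g - h).
Proof.
case=> e f1 g1 h1; split=> //; first by rewrite -e /fricke; ring.
move: f1 g1 h1; rewrite /at1 !(rmorphB, rmorphM, rmorph_nat) /= => -> -> ->.
by [].
Qed.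

Lemma trace_map_eval f g h (v : 'I_3 -> int) : is_trace_map f g h ->
  fricke f.@[v] g.@[v] h.@[v] = fricke (v 0) (v 1) (v 2).
Proof.
have E u w t : (fricke u w t : {mpoly int[3]}).@[v] = fricke u.@[v] w.@[v] t.@[v].
  by rewrite /fricke !(rmorphB, rmorphD, rmorphM, rmorphXn, rmorph1, rmorph_nat).
case=> e _ _ _; rewrite -E e -[fricke_vogt]/(fricke _ _ _) E.
by rewrite !mevalXU.
Qed.

Definition affine (a b c d : int) : {mpoly int[3]} :=
  a%:MP + b *: 'X_0 + c *: 'X_1 + d *: 'X_2.

Lemma affineP p : (msize p <= 2)%N -> exists a b c d, p = affine a b c d.
Proof.
move=> le2; rewrite [p]mpolyE big_seq_cond.
apply: (big_ind (fun p => exists a b c d, p = affine a b c d))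
  => [|u w [a [b [c [d ->]]]] [a' [b' [c' [d' ->]]]]|m].
- by exists 0, 0, 0, 0; rewrite /affine !scale0r !addr0.
- exists (a + a'), (b + b'), (c + c'), (d + d').
  by rewrite /affine mpolyCD !scalerDl; ring.
- rewrite andbT => /msize_mdeg_lt lt_m.
  have := leq_trans lt_m le2; rewrite ltnS leq_eqVlt ltnS leqn0.
  case/orP=> [/mdeg1P[i /eqP->]|]; last first.
    rewrite mdeg_eq0 => /eqP->; exists p@_0, 0, 0, 0.
    by rewrite /affine !scale0r !addr0 mpolyX0 alg_mpolyC.
  move: p@_ _ => r; elim/ord3P: i.
  + by exists 0, r, 0, 0; rewrite /affine mpolyC0 !scale0r !addr0 add0r.
  + by exists 0, 0, r, 0; rewrite /affine mpolyC0 !scale0r !addr0 !add0r.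
  + by exists 0, 0, 0, r; rewrite /affine mpolyC0 !scale0r !add0r.
Qed.

Lemma affine_eval a b c d v : (affine a b c d).@[v] = a + b * v 0 + c * v 1 + d * v 2.
Proof. by rewrite /affine !mevalD mevalC !mevalZ !mevalXU. Qed.

Lemma linear_form_eq0 (a b z : int) : `|a| < z -> a + b * z = 0 -> a = 0 /\ b = 0.
Proof.
move=> ltaz e; have [b0|b0] := eqVneq b 0; first by rewrite b0 mul0r addr0 in e.
suff: z <= `|a| by lia.
rewrite (_ : a = - (b * z)); last by lia.
have lez : `|b| * `|z| >= `|z| by rewrite ler_peMl //; lia.
by rewrite normrN normrM; lia.
Qed.

(* Evaluate at (1, z) with z larger than all coefficients. *)
Lemma prod_linear_forms_eq0 (a b c d e k : int) :
    (forall y z, (a * y + b * z) * (c * y + d * z) * (e * y + k * z) = 0) ->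
  [\/ a = 0 /\ b = 0, c = 0 /\ d = 0 | e = 0 /\ k = 0].
Proof.
move=> /(_ 1 (1 + `|a| + `|c| + `|e|))/eqP; rewrite !mulr1 !mulf_eq0 -orbA.
case/or3P=> /eqP/linear_form_eq0 H; [apply: Or31 | apply: Or32 | apply: Or33];
  by apply: H; lia.
Qed.

(* The third difference along the line t (x, y, z) isolates the cubic part. *)
Lemma affine_prod_xyz (f0 f1 f2 f3 g0 g1 g2 g3 h0 h1 h2 h3 : int) :
    (forall x y z, fricke (f0 + f1 * x + f2 * y + f3 * z)
       (g0 + g1 * x + g2 * y + g3 * z) (h0 + h1 * x + h2 * y + h3 * z) = fricke x y z) ->
  forall x y z, (f1 * x + f2 * y + f3 * z) * (g1 * x + g2 * y + g3 * z) *
                   (h1 * x + h2 * y + h3 * z) = x * y * z.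
Proof.
move=> H x y z; set F := _ + _ + _ * z; set G := _ + _ + g3 * z; set K := _ + _ + h3 * z.
pose d t := fricke (f0 + t * F) (g0 + t * G) (h0 + t * K) - fricke (t * x) (t * y) (t * z).
have d0 t : d t = 0.
  by apply/eqP; rewrite subr_eq0 -(H (t * x)); apply/eqP; congr fricke; rewrite /F /G /K; ring.
suff: 12 * (F * G * K - x * y * z) = 0 by lia.
transitivity (3 * d 2 - d 3 - 3 * d 1 + d 0); last by rewrite !d0.
move: F G K @d d0 => F G K d _; rewrite /d /fricke. ring.
Qed.

Lemma fricke_swap (R : comPzRingType) (x y z : R) : fricke x y z = fricke y x z.
Proof. by rewrite /fricke; ring. Qed.

Lemma fricke_swapr (R : comPzRingType) (x y z : R) : fricke x y z = fricke x z y.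
Proof. by rewrite /fricke; ring. Qed.

(** The mixed second difference in y and z at x = 0 isolates the coefficient -2 f0 g2 h3 of yz,
    which has to vanish; similarly for the other two pairs of variables. *)
Lemma diagonal_affine_sol (f0 f1 g0 g2 h0 h3 : int) :
    (forall x y z, fricke (f0 + f1 * x) (g0 + g2 * y) (h0 + h3 * z) = fricke x y z) ->
    f1 * g2 * h3 = 1 ->
  [/\ f0 = 0, g0 = 0 & h0 = 0].
Proof.
move=> H e.
pose d x y z := fricke (f0 + f1 * x) (g0 + g2 * y) (h0 + h3 * z) - fricke x y z.
have d0 x y z : d x y z = 0 by rewrite /d H subrr.
split.
- suff: 2 * f0 * (f1 * g2 * h3) = 0 by rewrite e; lia.
  transitivity (- f1 * (d 0 1 1 - d 0 1 0 - d 0 0 1 + d 0 0 0)); last by rewrite !d0; ring.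
  by rewrite /d /fricke; ring.
- suff: 2 * g0 * (f1 * g2 * h3) = 0 by rewrite e; lia.
  transitivity (- g2 * (d 1 0 1 - d 1 0 0 - d 0 0 1 + d 0 0 0)); last by rewrite !d0; ring.
  by rewrite /d /fricke; ring.
- suff: 2 * h0 * (f1 * g2 * h3) = 0 by rewrite e; lia.
  transitivity (- h3 * (d 1 1 0 - d 0 1 0 - d 1 0 0 + d 0 0 0)); last by rewrite !d0; ring.
  by rewrite /d /fricke; ring.
Qed.

(** The product of the linear parts is xyz, so setting a variable to 0 kills one of them: each
    variable divides some linear part. Only the six assignments that give the variables to different
    components survive; there the constant terms vanish, and the values at (1,1,1) exclude sign
    changes. *)
Lemma affine_sol (f0 f1 f2 f3 g0 g1 g2 g3 h0 h1 h2 h3 : int) :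
    (forall x y z, fricke (f0 + f1 * x + f2 * y + f3 * z)
       (g0 + g1 * x + g2 * y + g3 * z) (h0 + h1 * x + h2 * y + h3 * z) = fricke x y z) ->
    f0 + f1 + f2 + f3 = 1 -> g0 + g1 + g2 + g3 = 1 -> h0 + h1 + h2 + h3 = 1 ->
  perm_eq [:: (f0, f1, f2, f3); (g0, g1, g2, g3); (h0, h1, h2, h3)]
          [:: (0, 1, 0, 0); (0, 0, 1, 0); (0, 0, 0, 1)].
Proof.
move=> I Sf Sg Sh; have H := affine_prod_xyz I; have H1 := H 1 1 1.
have Ex : [\/ f2 = 0 /\ f3 = 0, g2 = 0 /\ g3 = 0 | h2 = 0 /\ h3 = 0].
  by apply: prod_linear_forms_eq0 => y z; have := H 0 y z; rewrite !mulr0 !add0r !mul0r.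
have Ey : [\/ f1 = 0 /\ f3 = 0, g1 = 0 /\ g3 = 0 | h1 = 0 /\ h3 = 0].
  apply: prod_linear_forms_eq0 => y z; have := H y 0 z.
  by rewrite !mulr0 !addr0 !mul0r.
have {H}Ez : [\/ f1 = 0 /\ f2 = 0, g1 = 0 /\ g2 = 0 | h1 = 0 /\ h2 = 0].
  by apply: prod_linear_forms_eq0 => y z; have := H y z 0; rewrite !mulr0 !addr0.
move: H1; rewrite !mulr1.
case: Ex => [][? ?]; case: Ey => [][? ?]; case: Ez => [][? ?]; subst;
  rewrite ?addr0 ?add0r ?(mulr0, mul0r) => E; try by [].
- have [||? ? ?] := @diagonal_affine_sol f0 f1 g0 g2 h0 h3.
  + by move=> x y z; rewrite -(I x y z); congr fricke; ring.
  + by rewrite -E; ring.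
  + have [? ? ?] : [/\ f1 = 1, g2 = 1 & h3 = 1] by split; lia.
    by subst.
- have [||? ? ?] := @diagonal_affine_sol f0 f1 h0 h2 g0 g3.
  + by move=> x y z; rewrite -(I x y z) [RHS]fricke_swapr; congr fricke; ring.
  + by rewrite -E; ring.
  + have [? ? ?] : [/\ f1 = 1, h2 = 1 & g3 = 1] by split; lia.
    by subst.
- have [||? ? ?] := @diagonal_affine_sol g0 g1 f0 f2 h0 h3.
  + by move=> x y z; rewrite -(I x y z) [RHS]fricke_swap; congr fricke; ring.
  + by rewrite -E; ring.
  + have [? ? ?] : [/\ g1 = 1, f2 = 1 & h3 = 1] by split; lia.
    by subst.
- have [||? ? ?] := @diagonal_affine_sol g0 g1 h0 h2 f0 f3.
  + by move=> x y z; rewrite -(I x y z) [RHS]fricke_swap [RHS]fricke_swapr; congr fricke; ring.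
  + by rewrite -E; ring.
  + have [? ? ?] : [/\ g1 = 1, h2 = 1 & f3 = 1] by split; lia.
    by subst.
- have [||? ? ?] := @diagonal_affine_sol h0 h1 f0 f2 g0 g3.
  + by move=> x y z; rewrite -(I x y z) [RHS]fricke_swapr [RHS]fricke_swap; congr fricke; ring.
  + by rewrite -E; ring.
  + have [? ? ?] : [/\ h1 = 1, f2 = 1 & g3 = 1] by split; lia.
    by subst.
- have [||? ? ?] := @diagonal_affine_sol h0 h1 g0 g2 f0 f3.
  + move=> x y z; rewrite -(I x y z) [RHS]fricke_swap [RHS]fricke_swapr [RHS]fricke_swap.
    by congr fricke; ring.
  + by rewrite -E; ring.
  + have [? ? ?] : [/\ h1 = 1, g2 = 1 & f3 = 1] by split; lia.
    by subst.
Qed.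

Lemma trace_map_affine f g h : is_trace_map f g h ->
    (msize f <= 2)%N -> (msize g <= 2)%N -> (msize h <= 2)%N ->
  is_perm_coords f g h.
Proof.
move=> I.
move=> /affineP[f0 [f1 [f2 [f3 ef]]]] /affineP[g0 [g1 [g2 [g3 eg]]]] /affineP[h0 [h1 [h2 [h3 eh]]]].
pose v x y z (i : 'I_3) : int := nth 0 [:: x; y; z] i.
have H x y z := trace_map_eval (v x y z) I.
case: I => _; rewrite ef eg eh /at1 !affine_eval !mulr1 => Sf Sg Sh.
have {H} /(perm_map (fun t : int * int * int * int => affine t.1.1.1 t.1.1.2 t.1.2 t.2)) :
    perm_eq [:: (f0, f1, f2, f3); (g0, g1, g2, g3); (h0, h1, h2, h3)]
          [:: (0, 1, 0, 0); (0, 0, 1, 0); (0, 0, 0, 1)].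
  apply: affine_sol => // x y z; have := H x y z.
  by rewrite ef eg eh !affine_eval.
by rewrite /= /is_perm_coords /affine mpolyC0 !scale0r !scale1r !add0r !addr0.
Qed.

Lemma at1_neq0 p : at1 p = 1 -> p != 0.
Proof. by apply: contra_eq_neq => ->; rewrite /at1 meval0. Qed.

Lemma trace_map_nonconstant f g h : is_trace_map f g h -> (1 < msize f)%N.
Proof.
move=> I; rewrite ltnNge; apply/negP => /msize1_polyC ef.
have f1 : f@_0 = 1 by case: I => _; rewrite ef /at1 mevalC mcoeffC eqxx mulr1.
(* With f = 1 the invariant is the square (g - h)^2, but it equals -5 at (2, 2, 2). *)
have := trace_map_eval (fun=> 2) I; rewrite ef f1 mevalC /fricke.
move: (meval _ g) (meval _ h) => u w.
have : (u - w) ^+ 2 >= 0 by exact: sqr_ge0.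
by lia.
Qed.

Lemma msize_mul2 (f g : {mpoly int[3]}) : msize (2 * f * g) = msize (f * g).
Proof. by rewrite -mulrA mulr_natl -scaler_nat msizeZ. Qed.

(** * Degree descent *)

Lemma msizeM_int (f g : {mpoly int[3]}) :
  f != 0 -> g != 0 -> msize (f * g) = (msize f + msize g).-1.
Proof. exact: msizeM. Qed.

Lemma msizeD_bound n (p q : {mpoly int[3]}) :
  (msize p <= n -> msize q <= n -> msize (p + q)%R <= n)%N.
Proof.
by move=> hp hq; apply: leq_trans (msizeD_le _ _) _; rewrite geq_max hp hq.
Qed.

Lemma msize_fricke_vogt : (msize (fricke_vogt + 1)%R <= 4)%N.
Proof.
have X0 (i : 'I_3) : ('X_i : {mpoly int[3]}) != 0.
  by rewrite -msize_poly_eq0 msizeX mdeg1.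
have X2 (i : 'I_3) : (msize ('X_i ^+ 2 : {mpoly int[3]}) <= 4)%N.
  by rewrite expr2 msizeM_int // msizeX mdeg1.
rewrite /fricke_vogt subrK -[_ * _ * 'X_2]mulrA.
do 3?[apply: msizeD_bound => //].
by rewrite msizeN msize_mul2 !msizeM_int ?mulf_neq0 // !msizeX !mdeg1.
Qed.

(* h and k = 2fg - h are the roots of a quadratic equation: h + k = 2fg and
   hk = f^2 + g^2 - (I + 1).  Recall that msize is the degree plus one. *)
Lemma trace_map_degrees f g h : is_trace_map f g h ->
    (msize f <= msize g)%N -> (msize g <= msize h)%N ->
  is_perm_coords f g h \/
  (msize f + msize g = (msize h).+1)%N /\ (msize (2 * f * g - h)%R < msize h)%N.
Proof.
move=> I le_fg le_gh; have f_gt1 := trace_map_nonconstant I.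
have [e f1 g1 h1] := I; have [_ _ _ k1] := is_trace_map_vieta I.
have [f0 g0 h0 k0] : [/\ f != 0, g != 0, h != 0 & 2 * f * g - h != 0].
  by split; apply: at1_neq0.
set k := 2 * f * g - h in k0 k1 *.
have sM := msize_mul2 f g; rewrite (msizeM_int f0 g0) in sM.
have sHK : (msize (h * k)%R <= maxn (msize g + msize g).-1 4)%N.
  have -> : h * k = f * f + g * g - (fricke_vogt + 1).
    by rewrite -e /k /fricke; ring.
  do 2?[apply: msizeD_bound].
  - by rewrite msizeM_int //; lia.
  - by rewrite msizeM_int // leq_maxl.
  - by rewrite msizeN; apply: leq_trans msize_fricke_vogt (leq_maxr _ _).
rewrite (msizeM_int h0 k0) in sHK.
have sH : (msize h <= maxn (msize (2 * f * g)%R) (msize k))%N.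
  by rewrite -(msizeN k) {1}(_ : h = 2 * f * g - k) ?msizeD_le // /k; ring.
have sK : (msize k <= maxn (msize (2 * f * g)%R) (msize h))%N.
  by rewrite -(msizeN h) msizeD_le.
have sHK' : (msize (2 * f * g)%R <= maxn (msize h) (msize k))%N.
  by rewrite {1}(_ : 2 * f * g = h + k) ?msizeD_le // /k; ring.
have k_gt0 : (0 < msize k)%N by rewrite lt0n msize_poly_eq0.
(* If k had at least the degree of h, and that degree is at least 2, the bound on hk would force g,
   h, k to have equal degree; then 2fg = h + k would have degree at most that of g, although f is
   not constant. So k has smaller degree, and h has the degree of fg. *)
have [h2|h_gt2] := leqP (msize h) 2; [left | right]; last by lia.
by apply: trace_map_affine => //; lia.
Qed.

Lemma triple_sym_ind (T : Type) (P : T -> T -> T -> Prop) (le : rel T) :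
    total le ->
    (forall x y z, P x y z -> P y x z) -> (forall x y z, P x y z -> P x z y) ->
    (forall x y z, le x y -> le y z -> P x y z) ->
  forall x y z, P x y z.
Proof.
move=> tot sw swr H x y z.
have := tot x y; have := tot y z; have := tot x z.
by do 3![case/orP=> ?]; first [exact: H | exact/sw/H
  | exact/swr/H | exact/sw/swr/H | exact/swr/sw/H | exact/sw/swr/sw/H].
Qed.

Lemma perm_eq3_ind (T : eqType) (P : T -> T -> T -> Prop) x y z :
    (forall x y z, P x y z -> P y x z) -> (forall x y z, P x y z -> P x z y) ->
    P x y z ->
  forall f g h, perm_eq [:: f; g; h] [:: x; y; z] -> P f g h.
Proof.
move=> sw swr.
have first u v w g h : P u v w -> perm_eq [:: u; g; h] [:: u; v; w] -> P u g h.
  rewrite perm_cons => Puvw E; have := perm_mem E g; rewrite !inE eqxx /=.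
  move=> /esym/orP[]/eqP eg; move: E; rewrite eg.
    by rewrite perm_cons => /perm_mem/(_ h); rewrite !inE eqxx => /esym/eqP->.
  rewrite perm_sym (perm_catC [:: v] [:: w]) perm_cons.
  move=> /perm_mem/(_ h); rewrite !inE eqxx => /eqP->; exact: swr.
move=> Pxyz f g h E; have := perm_mem E f; rewrite !inE eqxx /=.
case/esym/or3P => /eqP ef; move: E; rewrite ef.
- exact: first.
- by rewrite perm_sym (perm_catCA [:: x] [:: y] [:: z]) perm_sym; apply/first/sw.
- rewrite perm_sym (perm_catC [:: x; y] [:: z]) perm_sym; apply/first.
  by apply/sw/swr.
Qed.

(** * Gradients at (1,1,1) and their weights along the descent *)

Definition grad (p : {mpoly int[3]}) : 'rV[int]_3 := \row_j at1 p^`M(j).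

Lemma grad_vieta f g h : at1 f = 1 -> at1 g = 1 ->
  grad (2 * f * g - h) = 2 *: grad f + 2 *: grad g - grad h.
Proof.
move=> f1 g1; apply/rowP => j; rewrite !mxE.
have -> : 2 * f * g = (f * g) *+ 2 by rewrite -mulrA mulr_natl.
rewrite mderivB mderivMn mderivM /at1 mevalB mevalMn mevalD !mevalM.
by move: f1 g1; rewrite /at1 => -> ->; ring.
Qed.

(* The square of the linear form (a, b), in the basis (1,0)^2, (0,1)^2, (1,1)^2. *)
Definition sq (a b : int) : 'rV[int]_3 :=
  \row_j nth 0 [:: a ^+ 2 - a * b; b ^+ 2 - a * b; a * b] j.

(** On squares this is the positive definite form a^2 - ab + b^2, so it measures the size of the
    linear form (a, b). *)
Definition weight (u : 'rV[int]_3) : int := \sum_j u 0 j.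

Lemma weight_sq a b : weight (sq a b) = a ^+ 2 - a * b + b ^+ 2.
Proof. by rewrite /weight !big_ord_recl big_ord0 !mxE /=; ring. Qed.

Lemma weight_sq_ge0 a b : 0 <= weight (sq a b).
Proof.
rewrite weight_sq.
have := sqr_ge0 (a - b); have := sqr_ge0 a; have := sqr_ge0 b.
by rewrite !expr2; lia.
Qed.

(** Matches [grad_vieta] term by term: if f, g, h belong to v1, v2, v1 + v2, then 2fg - h belongs to
    v1 - v2. *)
Lemma sq_parallelogram a b c d :
  sq (a - c) (b - d) = 2 *: sq a b + 2 *: sq c d - sq (a + c) (b + d).
Proof. by apply/rowP; apply: ord3P; rewrite !mxE /=; ring. Qed.

Lemma sq_opp a b : sq (- a) (- b) = sq a b.
Proof. by apply/rowP; apply: ord3P; rewrite !mxE /=; ring. Qed.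

Definition wt p : int := weight (grad p).

(* Carried along the descent, this bounds the weight of a gradient from below, so that
   only permutations of the coordinates have all weights equal to 1. *)
Definition dominated (f g h : {mpoly int[3]}) : Prop :=
  (msize f + msize g = (msize h).+1)%N -> wt f + wt g <= wt h.

(** A superbase of the lattice Z^2: v1, v2 and -(v1 + v2) have sum zero, any two of them form a
    basis, and signs are invisible in the squares. Hence the symmetry in f, g, h. *)
Definition unimodular_frame f g h : Prop := exists a b c d : int,
  [/\ `|a * d - b * c| = 1, grad f = sq a b, grad g = sq c d
    & grad h = sq (a + c) (b + d)].

Definition graded_frame f g h : Prop :=
  [/\ unimodular_frame f g h, dominated f g h, dominated g h f & dominated f h g].

Lemma dominated_swap f g h : dominated f g h -> dominated g f h.
Proof. by rewrite /dominated addnC addrC. Qed.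

Lemma unimodular_frame_swap f g h :
  unimodular_frame f g h -> unimodular_frame g f h.
Proof.
move=> [a [b [c [d [D ef eg eh]]]]]; exists c, d, a, b; split=> //.
  by rewrite -D -normrN; congr `|_|; ring.
by rewrite eh addrC [b + d]addrC.
Qed.

Lemma unimodular_frame_swapr f g h :
  unimodular_frame f g h -> unimodular_frame f h g.
Proof.
move=> [a [b [c [d [D ef eg eh]]]]]; exists a, b, (- (a + c)), (- (b + d)); split=> //.
- by rewrite -D -normrN; congr `|_|; ring.
- by rewrite sq_opp.
- by rewrite eg -sq_opp; congr sq; ring.
Qed.

Lemma graded_frame_swap f g h : graded_frame f g h -> graded_frame g f h.
Proof.
by case=> /unimodular_frame_swap ? /dominated_swap.
Qed.

Lemma graded_frame_swapr f g h : graded_frame f g h -> graded_frame f h g.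
Proof.
by case=> /unimodular_frame_swapr ? ? /dominated_swap.
Qed.

Lemma graded_frame_perm_coords f g h : is_perm_coords f g h -> graded_frame f g h.
Proof.
apply: perm_eq3_ind => {f g h}; first exact: graded_frame_swap.
  exact: graded_frame_swapr.
split; try by rewrite /dominated !msizeX !mdeg1.
exists 1, 0, 0, 1.
by split=> //; apply/rowP; apply: ord3P; rewrite !mxE mderivXU /at1 rmorph_nat.
Qed.

Lemma wt_perm_coords f g h :
  is_perm_coords f g h -> [/\ wt f = 1, wt g = 1 & wt h = 1].
Proof.
apply: (@perm_eq3_ind _ (fun f g h => [/\ wt f = 1, wt g = 1 & wt h = 1]))
  => [? ? ? []|? ? ? []|] //.
by split; rewrite /wt /weight !big_ord_recl big_ord0 !mxE !mderivXU /at1 !rmorph_nat.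
Qed.

Lemma trace_map_degrees_any f g h : is_trace_map f g h ->
  [\/ is_perm_coords f g h, (msize f + msize g = (msize h).+1)%N,
      (msize g + msize h = (msize f).+1)%N | (msize f + msize h = (msize g).+1)%N].
Proof.
move: f g h.
apply: (@triple_sym_ind _ _ (fun f g : {mpoly int[3]} => (msize f <= msize g)%N)).
- by move=> f g; apply: leq_total.
- move=> f g h H /is_trace_map_swap/H; rewrite -is_perm_coords_swap.
  by case; [apply: Or41|rewrite addnC; apply: Or42|apply: Or44|apply: Or43].
- move=> f g h H /is_trace_map_swapr/H; rewrite -is_perm_coords_swapr.
  by case; [apply: Or41|apply: Or44|rewrite addnC; apply: Or43|apply: Or42].
- by move=> f g h le1 le2 /trace_map_degrees[|//|/Or41|[/Or42]].
Qed.

Lemma trace_map_graded_frame f g h : is_trace_map f g h -> graded_frame f g h.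
Proof.
have [n] := ubnP (msize f + msize g + msize h)%N.
elim: n f g h => // n IH.
apply: (@triple_sym_ind _ _ (fun f g : {mpoly int[3]} => (msize f <= msize g)%N)).
- by move=> f g; apply: leq_total.
- move=> f g h H lt_n /is_trace_map_swap I; apply/graded_frame_swap/H => //.
  by rewrite -(addnC (msize g)).
- move=> f g h H lt_n /is_trace_map_swapr I; apply/graded_frame_swapr/H => //.
  by rewrite addnAC.
move=> f g h le_fg le_gh lt_n I.
have [/graded_frame_perm_coords//|[sz lt_k]] := trace_map_degrees I le_fg le_gh.
have f_gt1 := trace_map_nonconstant I.
have Ik := is_trace_map_vieta I; set k := 2 * f * g - h in lt_k Ik.
have [|[a [b [c [d [D ef eg ek]]]]] D1 D2 D3] := IH f g k _ Ik.
  by rewrite ltnS in lt_n; apply: leq_trans lt_n; rewrite ltn_add2l.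
have [_ f1 g1 _] := I.
have eh : grad h = 2 *: grad f + 2 *: grad g - grad k.
  by rewrite -grad_vieta // /k; congr grad; ring.
have wh : wt h = 2 * wt f + 2 * wt g - wt k.
  rewrite /wt eh /weight !mulr_sumr -big_split -sumrB; apply: eq_bigr => j _.
  by rewrite !mxE.
have [wf wg wk] : [/\ 0 <= wt f, 0 <= wt g & 0 <= wt k].
  by rewrite /wt ef eg ek !weight_sq_ge0.
(* The other two domination clauses are vacuous: their degree hypotheses, combined with [sz], would
   make g or f constant. *)
split; try by rewrite /dominated; lia.
  exists a, b, (- c), (- d); split=> //.
  - by rewrite -D -normrN; congr `|_|; ring.
  - by rewrite sq_opp.
  - by rewrite eh ek ef eg -sq_parallelogram.
(* What remains is wt k <= wt f + wt g. As k has lower degree than fg, the reduced triple is either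
   a permutation of the coordinates, with all weights 1, or dominated by f or g; in the latter cases
   wt k is at most the difference of the other two weights. *)
move=> _; rewrite wh.
have [|s|/D2 s|/D3 s] := trace_map_degrees_any Ik.
- by case/wt_perm_coords => -> -> ->.
- by lia.
- by lia.
- by lia.
Qed.

(** All three gradients have weight 1, so a component whose degree is the sum of the other two would
    give 1 + 1 <= 1. Hence F permutes the coordinates, and the Jacobian rules out every nontrivial
    permutation. *)
Lemma jac_eq1 F : F \in nielsen -> jac F = 1 -> F = pm_id.
Proof.
rewrite pm_idE [F in F \in _]tripleE => /nielsenP I J.
have G i : grad (tnth F i) = row i 1.
  by rewrite -J; apply/rowP => j; rewrite !mxE.
have W i : wt (tnth F i) = 1.
  rewrite /wt G /weight (bigD1 i) //= big1 ?addr0 ?mxE ?eqxx // => j /negPf.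
  by rewrite !mxE eq_sym => ->.
have [_] := trace_map_graded_frame I; rewrite /dominated !W => D1 D2 D3.
have {}P : is_perm_coords (tnth F 0) (tnth F 1) (tnth F 2).
  by have [//|/D1|/D2|/D3] := trace_map_degrees_any I.
have X i : tnth F i = 'X_i.
  have : tnth F i \in [:: 'X_0; 'X_1; 'X_2].
    rewrite -(perm_mem P) !inE; move: i {W G}; apply: ord3P; by rewrite eqxx ?orbT.
  rewrite !inE => H.
  have [j ej] : exists j, tnth F i = 'X_j.
    by case/or3P: H => /eqP->; eexists.
  rewrite ej; congr 'X_ _; apply/eqP.
  have := congr1 (fun u : 'rV[int]_3 => u 0 i) (G i).
  rewrite ej !mxE eqxx mderivXU /at1 rmorph_nat; by case: (j == i).
by rewrite [LHS]tripleE !X.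
Qed.

(** * Trace maps of integral matrices *)

Definition mx2 (a b c d : int) : 'M[int]_2 :=
  \matrix_(i, j) nth 0 (nth [::] [:: [:: a; b]; [:: c; d]] i) j.

Lemma mx2_eta (M : 'M[int]_2) : M = mx2 (M 0 0) (M 0 1) (M 1 0) (M 1 1).
Proof.
by apply/matrixP => -[[|[|//]] ?] [[|[|//]] ?]; rewrite mxE /=;
  congr (M _ _); apply: val_inj.
Qed.

Lemma mx2_inj a b c d a' b' c' d' :
  mx2 a b c d = mx2 a' b' c' d' -> [/\ a = a', b = b', c = c' & d = d'].
Proof.
move=> /matrixP E; have := E 0 0; have := E 0 1; have := E 1 0; have := E 1 1.
by rewrite !mxE.
Qed.

Lemma mx2M a b c d a' b' c' d' : mx2 a b c d * mx2 a' b' c' d' =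
  mx2 (a * a' + b * c') (a * b' + b * d') (c * a' + d * c') (c * b' + d * d').
Proof.
by apply/matrixP => -[[|[|//]] ?] [[|[|//]] ?];
  rewrite !mxE !big_ord_recl big_ord0 !mxE /= addr0.
Qed.

Lemma mx2N a b c d : - mx2 a b c d = mx2 (- a) (- b) (- c) (- d).
Proof. by apply/matrixP => -[[|[|//]] ?] [[|[|//]] ?]; rewrite !mxE. Qed.

Lemma mx2_1 : 1 = mx2 1 0 0 1.
Proof. by apply/matrixP => -[[|[|//]] ?] [[|[|//]] ?]; rewrite !mxE. Qed.

Lemma det_mx2 a b c d : \det (mx2 a b c d) = a * d - b * c.
Proof.
by rewrite (expand_det_row _ 0) !big_ord_recl big_ord0 /cofactor !det_mx11 !mxE /=; ring.
Qed.

Lemma unit_mx2 a b c d : (mx2 a b c d \is a GRing.unit) = (`|a * d - b * c| == 1).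
Proof.
rewrite -[_ \is a _]/(_ \in unitmx) unitmxE det_mx2.
move: (_ - _) => x; rewrite -[x \is a _]/((x == 1) || (x == - 1)); lia.
Qed.

Definition sym2 (M : 'M[int]_2) : 'M[int]_3 := \matrix_(i < 3)
  nth 0 [:: sq (M 0 0) (M 0 1); sq (M 1 0) (M 1 1);
            sq (M 0 0 + M 1 0) (M 0 1 + M 1 1)] i.

Lemma sq_sym2 a b (N : 'M[int]_2) :
  sq a b *m sym2 N = sq (a * N 0 0 + b * N 1 0) (a * N 0 1 + b * N 1 1).
Proof.
apply/rowP; apply: ord3P; rewrite mxE !big_ord_recl big_ord0 !mxE /= ?mxE /=.
- by ring.
- by ring.
- by ring.
Qed.

Lemma sym2M (M N : 'M[int]_2) : sym2 (M * N) = sym2 M *m sym2 N.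
Proof.
have E i j : (M * N) i j = M i 0 * N 0 j + M i 1 * N 1 j.
  by rewrite mxE !big_ord_recl big_ord0 addr0; congr (_ + M i _ * N _ j); apply: val_inj.
apply/row_matrixP; apply: ord3P; rewrite row_mul !rowK /= sq_sym2 !E //.
by congr sq; rewrite !mulrDl addrACA.
Qed.

Lemma sym2_1 : sym2 1 = 1.
Proof.
by rewrite mx2_1; apply/matrixP; apply: ord3P; apply: ord3P; rewrite !mxE /= ?mxE /=.
Qed.

Lemma sym2N (M : 'M[int]_2) : sym2 (- M) = sym2 M.
Proof.
by apply/row_matrixP; apply: ord3P; rewrite !rowK /= !mxE -?opprD sq_opp.
Qed.

Lemma eq_up_to_sign (x y z t x' y' z' t' : int) : x != 0 -> x ^+ 2 = x' ^+ 2 ->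
    x * y = x' * y' -> x * z = x' * z' -> x * t = x' * t' ->
  [/\ x = x', y = y', z = z' & t = t'] \/ [/\ x = - x', y = - y', z = - z' & t = - t'].
Proof.
move=> x0 /eqP; rewrite eqf_sqr => /orP[]/eqP e; rewrite e in x0 *.
  by move=> /(mulfI x0) -> /(mulfI x0) -> /(mulfI x0) ->; left.
rewrite oppr_eq0 in x0; rewrite !mulNr -!mulrN.
by move=> /(mulfI x0) <- /(mulfI x0) <- /(mulfI x0) <-; right; rewrite !opprK.
Qed.

Lemma sq_eq a b a' b' : sq a b = sq a' b' ->
  [/\ a ^+ 2 = a' ^+ 2, b ^+ 2 = b' ^+ 2 & a * b = a' * b'].
Proof. by move=> /rowP E; have := E 0; have := E 1; have := E 2; rewrite !mxE /=; split; lia. Qed.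

Lemma sym2_inj (M N : 'M[int]_2) : sym2 M = sym2 N -> M = N \/ M = - N.
Proof.
move=> /row_matrixP E; have := E 0; have := E 1; have := E 2; rewrite !rowK {E} /=.
move=> E2 E1 E0; rewrite [M]mx2_eta [N]mx2_eta mx2N; move: E2 E1 E0.
move: (M 0 0) (M 0 1) (M 1 0) (M 1 1) (N 0 0) (N 0 1) (N 1 0) (N 1 1).
move=> a b c d a' b' c' d' /sq_eq[] eac ebd ead /sq_eq[ec ed ecd] /sq_eq[ea eb eab].
rewrite !sqrrD ea ec in eac; rewrite !sqrrD eb ed in ebd.
have {}eac : a * c = a' * c' by clear -eac; lia.
have {}ebd : b * d = b' * d' by clear -ebd; lia.
have {}ead : a * d + b * c = a' * d' + b' * c'.
  by move: ead; rewrite !mulrDl !mulrDr eab ecd; clear; lia.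
have [a0|a0] := eqVneq a 0; last first.
  (* Only the sum ad + bc is known; (ab)(ac) = a^2 (bc) separates its terms when a is nonzero.
     Afterwards the first nonzero entry serves as the pivot that fixes the common sign. *)
  have ead' : a * d = a' * d'.
    suff ebc : b * c = b' * c' by move: ead; rewrite ebc => /addIr.
    apply: (mulfI (mulf_neq0 a0 a0)); transitivity (a * b * (a * c)); first by ring.
    by rewrite eab eac; transitivity (a' ^+ 2 * (b' * c')); [ring | rewrite -ea; ring].
  by case: (eq_up_to_sign a0 ea eab eac ead') => -[-> -> -> ->]; [left | right].
have a0' : a' = 0 by apply/eqP; rewrite -sqrf_eq0 -ea a0 expr0n.
rewrite {}a0 {}a0' in eab eac ead *.
have [b0|b0] := eqVneq b 0; last first.
  have ebc' : b * c = b' * c' by move: ead; rewrite !mul0r !add0r.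
  have eb0 : b * 0 = b' * 0 by rewrite !mulr0.
  by case: (eq_up_to_sign b0 eb eb0 ebc' ebd) => -[-> _ -> ->]; [left | right; rewrite oppr0].
have b0' : b' = 0 by apply/eqP; rewrite -sqrf_eq0 -eb b0 expr0n.
rewrite {}b0 {}b0' in ebd *.
have [c0|c0] := eqVneq c 0; last first.
  have ec0 : c * 0 = c' * 0 by rewrite !mulr0.
  by case: (eq_up_to_sign c0 ec ec0 ec0 ecd) => -[-> _ _ ->]; [left | right; rewrite oppr0].
have c0' : c' = 0 by apply/eqP; rewrite -sqrf_eq0 -ec c0 expr0n.
move/eqP: ed; rewrite c0 c0' eqf_sqr => /orP[]/eqP->; first by left.
by right; rewrite oppr0.
Qed.

(** * Realizing unimodular matrices by trace maps *)

Definition realizable (a b c d : int) : Prop := exists f g h,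
  [/\ is_trace_map f g h, grad f = sq a b, grad g = sq c d & grad h = sq (a + c) (b + d)].

Lemma realizable1 : realizable 1 0 0 1.
Proof.
exists 'X_0, 'X_1, 'X_2; split; first by apply/nielsenP; rewrite -pm_idE nielsen_id.
- by apply/rowP; apply: ord3P; rewrite !mxE mderivXU /at1 rmorph_nat.
- by apply/rowP; apply: ord3P; rewrite !mxE mderivXU /at1 rmorph_nat.
- by apply/rowP; apply: ord3P; rewrite !mxE mderivXU /at1 rmorph_nat.
Qed.

Lemma realizable_swap a b c d : realizable a b c d -> realizable c d a b.
Proof.
case=> f [g [h [I ef eg eh]]]; exists g, f, h; split=> //.
  exact: is_trace_map_swap.
by rewrite eh addrC [b + d]addrC.
Qed.

(** Negating v2 turns v1 + v2 into v1 - v2, which is the Vieta move on h. *)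
Lemma realizable_opp a b c d : realizable a b c d -> realizable a b (- c) (- d).
Proof.
case=> f [g [h [I ef eg eh]]]; exists f, g, (2 * f * g - h); split=> //.
- exact: is_trace_map_vieta.
- by rewrite sq_opp.
- by rewrite sq_parallelogram -ef -eg -eh grad_vieta //; case: I.
Qed.

(** Exchanging g and h replaces v2 by -(v1 + v2), and [realizable_opp] corrects the sign. *)
Lemma realizable_add a b c d : realizable a b c d -> realizable a b (c + a) (d + b).
Proof.
case=> f [g [h [I ef eg eh]]]; rewrite -[c + a]opprK -[d + b]opprK.
apply: realizable_opp; exists f, h, g; split=> //; first exact: is_trace_map_swapr.
- by rewrite sq_opp eh addrC [b + d]addrC.
- by rewrite eg -sq_opp; congr sq; ring.
Qed.

Lemma realizable_addM k a b c d :
  realizable a b c d -> realizable a b (c + k * a) (d + k * b).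
Proof.
have pos n : forall c d, realizable a b c d -> realizable a b (c + n%:Z * a) (d + n%:Z * b).
  elim: n => [|n IH] {}c {}d R; first by rewrite !mul0r !addr0.
  by rewrite -addn1 PoszD !mulrDl !mul1r !addrA; apply/realizable_add/IH.
case: k => n R; first exact: pos.
rewrite -[c + _]opprK -[d + _]opprK; apply: realizable_opp.
rewrite NegzE !mulNr !opprB [_ - c]addrC [_ - d]addrC; apply/pos.
exact: realizable_opp.
Qed.

Lemma realizable_diag (x y : int) : `|x| = 1 -> `|y| = 1 -> realizable x 0 0 y.
Proof.
have sgn (z : int) : `|z| = 1 -> z = 1 \/ z = - 1.
  by case: (lerP 0 z) => ? ?; [left | right]; lia.
move=> /sgn[]-> /sgn[]->; first exact: realizable1.
- by rewrite -{2}oppr0; apply/realizable_opp/realizable1.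
- by rewrite -{1}oppr0; apply/realizable_swap/realizable_opp/realizable_swap/realizable1.
- rewrite -{1}oppr0; apply/realizable_swap/realizable_opp/realizable_swap.
  by rewrite -{2}oppr0; apply/realizable_opp/realizable1.
Qed.

(** Euclid's algorithm on the first column: c is reduced modulo a, then the rows are swapped, until
    a = 0. *)
Lemma unimodular_realizable (a b c d : int) : `|a * d - b * c| = 1 -> realizable a b c d.
Proof.
have [n] := ubnP `|a|%N; elim: n a b c d => // n IH a b c d lt_n D.
have [a0|a0] := eqVneq a 0.
  rewrite a0 mul0r sub0r normrN normrM in D *.
  have [db dc] : `|b| = 1 /\ `|c| = 1.
    move: D; rewrite -!abszE -PoszM => -[] /eqP; rewrite muln_eq1.
    by case/andP => /eqP-> /eqP->.
  (* As b^2 = 1, the entry d is the multiple (d b) b of b, so a row operation clears it. *)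
  have -> : realizable 0 b c d = realizable 0 b (c + d * b * 0) (0 + d * b * b).
    by rewrite mulr0 addr0 add0r -mulrA -expr2 -real_normK ?num_real // db expr1n mulr1.
  by apply/realizable_addM/realizable_swap/realizable_diag.
have -> : realizable a b c d =
    realizable a b ((c %% a)%Z + (c %/ a)%Z * a) (d - (c %/ a)%Z * b + (c %/ a)%Z * b).
  by rewrite [(c %% a)%Z + _]addrC -divz_eq subrK.
apply/realizable_addM/realizable_swap/IH.
  rewrite ltnS in lt_n; apply: leq_trans lt_n.
  by have := modz_ge0 c a0; have := ltz_mod c a0; lia.
rewrite -[RHS]D -normrN; congr `|_|; rewrite {3}(divz_eq c a); ring.
Qed.

Lemma nielsen_realize (M : 'M[int]_2) : M \is a GRing.unit ->
  exists2 F, F \in nielsen & jac F = sym2 M.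
Proof.
rewrite [M]mx2_eta unit_mx2 => /eqP/unimodular_realizable[f [g [h [I ef eg eh]]]].
exists (triple f g h); first exact/nielsenP.
apply/row_matrixP => i; rewrite rowK.
have -> : row i (jac (triple f g h)) = grad (tnth (triple f g h) i).
  by apply/rowP => j; rewrite !mxE.
by move: i; apply: ord3P; rewrite (tnth_nth 0) /= !mxE.
Qed.

Lemma nielsen_matrix F : F \in nielsen ->
  exists2 M : 'M[int]_2, M \is a GRing.unit & jac F = sym2 M.
Proof.
rewrite [F in F \in _]tripleE => /nielsenP/trace_map_graded_frame[].
case=> a [b [c [d [D ef eg eh]]]] _ _ _; exists (mx2 a b c d).
  by rewrite unit_mx2 D.
apply/row_matrixP => i; rewrite rowK.
have -> : row i (jac F) = grad (tnth F i).
  by apply/rowP => j; rewrite !mxE.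
by move: i; apply: ord3P; rewrite /= !mxE.
Qed.

(** Boolean form, from which [sig2W] can choose a map. *)
Lemma nielsen_realize_eq (M : 'M[int]_2) : M \is a GRing.unit ->
  exists2 F : polymap, F \in nielsen & jac F == sym2 M.
Proof. by case/nielsen_realize => F FN FM; exists F; rewrite // FM. Qed.

(* Junk value [pm_id] when [M] is not invertible. *)
Definition trace_map (M : 'M[int]_2) : polymap :=
  if insub M is Some u then s2val (sig2W (nielsen_realize_eq (valP (u : {x | x \is a GRing.unit}))))
  else pm_id.

Lemma trace_mapP M : M \is a GRing.unit ->
  trace_map M \in nielsen /\ jac (trace_map M) = sym2 M.
Proof.
move=> UM; rewrite /trace_map insubT; case: sig2W => F /= FN /eqP.
by [].
Qed.

Lemma jac_sym2_1_id F : F \in nielsen -> jac F = sym2 1 -> F = pm_id.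
Proof. by move=> FN; rewrite sym2_1; apply: jac_eq1. Qed.

(** A trivial kernel does not suffice while Nielsen maps are not known to be invertible; the
    realization of the inverse matrix provides the map to cancel with. *)
Lemma jac_inj F G : F \in nielsen -> G \in nielsen -> jac F = jac G -> F = G.
Proof.
move=> FN GN eFG; have [M UM FM] := nielsen_matrix FN.
have [N1 J1] := trace_mapP UM.
have [N2 J2] : trace_map M^-1 \in nielsen /\ _ := trace_mapP (etrans (unitrV M) UM).
have inv H : H \in nielsen -> jac H = sym2 M -> H = trace_map M.
  move=> HN HM; rewrite -[H]pm_id_comp.
  have <- : pm_comp (trace_map M) (trace_map M^-1) = pm_id.
    by apply: jac_sym2_1_id; rewrite ?nielsen_comp // jac_comp // J1 J2 -sym2M mulrV.
  rewrite -pm_compA.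
  have -> : pm_comp (trace_map M^-1) H = pm_id; last by rewrite pm_comp_id.
  by apply: jac_sym2_1_id; rewrite ?nielsen_comp // jac_comp // HM J2 -sym2M mulVr.
by rewrite [LHS]inv // [RHS]inv // -eFG.
Qed.

Lemma unitr_mul (R : unitRingType) (x y : R) :
  x \is a GRing.unit -> y \is a GRing.unit -> x * y \is a GRing.unit.
Proof. by move=> Ux Uy; rewrite unitrMl. Qed.

Lemma trace_mapM M N : M \is a GRing.unit -> N \is a GRing.unit ->
  trace_map (M * N) = pm_comp (trace_map M) (trace_map N).
Proof.
move=> UM UN; have [N1 J1] := trace_mapP UM; have [N2 J2] := trace_mapP UN.
have [N3 J3] : trace_map (M * N) \in nielsen /\ _ := trace_mapP (unitr_mul UM UN).
by apply: jac_inj; rewrite ?nielsen_comp // J3 jac_comp // J1 J2 sym2M.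
Qed.

Lemma trace_map1 : trace_map 1 = pm_id.
Proof. by have [N J] := trace_mapP (unitr1 'M[int]_2); apply: jac_sym2_1_id. Qed.

Lemma trace_map_eq M N : M \is a GRing.unit -> N \is a GRing.unit ->
  trace_map M = trace_map N <-> M = N \/ M = - N.
Proof.
move=> UM UN; have [N1 J1] := trace_mapP UM; have [N2 J2] := trace_mapP UN.
split=> [e|e]; first by apply: sym2_inj; rewrite -J1 -J2 e.
by apply: jac_inj => //; rewrite J1 J2; case: e => ->; rewrite ?sym2N.
Qed.

Lemma trace_map_surj F : F \in nielsen ->
  exists2 M : 'M[int]_2, M \is a GRing.unit & F = trace_map M.
Proof.
move=> FN; have [M UM FM] := nielsen_matrix FN; exists M => //.
by have [N1 J1] := trace_mapP UM; apply: jac_inj; rewrite // J1.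
Qed.

Lemma trace_map_symmetry A M : A \is a GRing.unit -> M \is a GRing.unit ->
  trace_map M \in symmetry (trace_map A) <-> A * M = M * A \/ A * M = - (M * A).
Proof.
move=> UA UM; rewrite inE; have [-> _] := trace_mapP UM.
rewrite -!trace_mapM //= -trace_map_eq ?unitr_mul //.
by split=> [/eqP|->].
Qed.

(** * Centralizers in PGL(2,Z) *)

Section UpToSign.
Context (R : pzRingType).
Implicit Types x y z t : R.

(** For invertible matrices this is equality in PGL(2,Z); computing with representatives avoids the
    quotient group. *)
Definition eqpm x y : bool := (x == y) || (x == - y).

Lemma eqpmP x y : reflect (x = y \/ x = - y) (eqpm x y).
Proof.
by apply: (iffP orP) => -[|] /eqP; by [left | right].
Qed.

Lemma eqpm_refl x : eqpm x x.
Proof. by rewrite /eqpm eqxx. Qed.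

Lemma eqpm_sym x y : eqpm x y = eqpm y x.
Proof. by rewrite /eqpm [y == x]eq_sym [y == - x]eq_sym eqr_oppLR. Qed.

Lemma eqpm_trans : transitive eqpm.
Proof.
by move=> y x z /eqpmP[]-> /eqpmP[]->; rewrite /eqpm ?opprK eqxx ?orbT.
Qed.

Lemma eqpm_mul x y z t : eqpm x y -> eqpm z t -> eqpm (x * z) (y * t).
Proof.
by move=> /eqpmP[]-> /eqpmP[]->; rewrite /eqpm ?mulrN ?mulNr ?opprK eqxx ?orbT.
Qed.

Lemma eqpm_exp n x y : eqpm x y -> eqpm (x ^+ n) (y ^+ n).
Proof.
by move=> e; elim: n => [|n IH]; rewrite ?eqpm_refl // !exprS eqpm_mul.
Qed.

End UpToSign.

(** Common bridge for the three types of A: [psi] need only be a homomorphism up to sign, because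
    trace maps do not see the sign. *)
Lemma pm_isog_trace_map (A : 'M[int]_2) (Z : zmodType) (psi : Z -> 'M[int]_2) :
    A \is a GRing.unit -> (forall a, psi a \is a GRing.unit) ->
    (forall a b, eqpm (psi (a + b)) (psi a * psi b)) ->
    (forall a, eqpm (psi a) 1 -> a = 0) ->
    (forall a, eqpm (A * psi a) (psi a * A)) ->
    (forall M, M \is a GRing.unit -> eqpm (A * M) (M * A) -> exists a, eqpm M (psi a)) ->
  pm_isog (symmetry (trace_map A)) Z.
Proof.
move=> UA U H inj com surj; exists (fun a => trace_map (psi a)); split.
- move=> a b /trace_map_eq-/(_ (U a) (U b))/eqpmP e; apply/eqP; rewrite -subr_eq0.
  apply/eqP/inj; have E : eqpm (psi (a - b) * psi b) (psi b).
    rewrite eqpm_sym; apply: eqpm_trans (H _ _); by rewrite subrK eqpm_sym.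
  by have := eqpm_mul E (eqpm_refl (psi b)^-1); rewrite mulrK // mulrV.
- move=> S; split=> [SS|[a <-]]; last exact/trace_map_symmetry/eqpmP.
  have /andP[/trace_map_surj[M UM eS] _] := SS.
  move: SS; rewrite eS => /trace_map_symmetry-/(_ UA UM)/eqpmP/surj-/(_ UM)[a e].
  by exists a; apply/trace_map_eq => //; apply/eqpmP; rewrite eqpm_sym.
- by move=> a b; rewrite -trace_mapM //; apply/trace_map_eq; rewrite ?unitr_mul //; apply/eqpmP.
Qed.

(** * The commutant of a matrix as a quadratic order *)

Lemma mx2V (M : 'M[int]_2) : M \is a GRing.unit ->
  M^-1 = mx2 (\det M * M 1 1) (- (\det M * M 0 1)) (- (\det M * M 1 0)) (\det M * M 0 0).
Proof.
move=> UM; have := UM; rewrite {1}[M]mx2_eta unit_mx2 -det_mx2 -mx2_eta => /eqP D1.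
have D2 : \det M * \det M = 1 by rewrite -expr2 -real_normK ?num_real // D1 expr1n.
apply: (mulrI UM); rewrite mulrV // {1}[M]mx2_eta mx2M mx2_1.
have eD : \det M = M 0 0 * M 1 1 - M 0 1 * M 1 0 by rewrite {1}[M]mx2_eta det_mx2.
have {}D2 : 1 = \det M * (M 0 0 * M 1 1 - M 0 1 * M 1 0) by rewrite -eD.
by congr mx2; [rewrite D2| | |rewrite D2]; ring.
Qed.

(* M = (x - y u) / 2 + y B with B = [u v; w 0] and x = tr M; here u^2 + 4vw is the
   discriminant of the order Z[B]. *)
Definition coords (u v w : int) (M : 'M[int]_2) (x y : int) : Prop :=
  [/\ M 0 0 + M 1 1 = x, M 0 0 - M 1 1 = y * u, M 0 1 = y * v & M 1 0 = y * w].

Section Coords.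
Variables u v w : int.
Let D := u ^+ 2 + 4 * v * w.

Lemma coords_inj M N x y : coords u v w M x y -> coords u v w N x y -> M = N.
Proof.
case=> a1 a2 a3 a4 [b1 b2 b3 b4]; rewrite (mx2_eta M) (mx2_eta N).
rewrite a3 a4 b3 b4 {a3 a4 b3 b4}; move: a1 a2 b1 b2.
move: (M 0 0) (M 1 1) (N 0 0) (N 1 1) => a d a' d' a1 a2 b1 b2.
by congr mx2; lia.
Qed.

Lemma coordsN M x y : coords u v w M x y -> coords u v w (- M) (- x) (- y).
Proof.
rewrite /coords !mxE; move: (M 0 0) (M 0 1) (M 1 0) (M 1 1) => a b c d [<- e -> ->].
by rewrite !mulNr -e; split=> //; ring.
Qed.

Lemma coords_eqpm M N x y x' y' : coords u v w M x y -> coords u v w N x' y' ->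
  x = x' /\ y = y' \/ x = - x' /\ y = - y' -> eqpm M N.
Proof.
move=> CM CN; case=> -[ex ey]; rewrite ex ey in CM.
  by rewrite (coords_inj CM CN) eqpm_refl.
by apply/eqpmP; right; apply: coords_inj CM (coordsN CN).
Qed.

Lemma coords1 : coords u v w 1 2 0.
Proof. by rewrite /coords mx2_1 !mxE !mul0r. Qed.

(** M stands for the number (x + y sqrt D) / 2, and this is its norm equation; [coordsM] and
    [coordsV] below are multiplication and inversion of such numbers. *)
Lemma coords_det M x y : coords u v w M x y -> x ^+ 2 - y ^+ 2 * D = 4 * \det M.
Proof.
case; rewrite [M]mx2_eta det_mx2 !mxE /= => a1 a2 a3 a4.
rewrite a3 a4 -a1 /D.
transitivity ((M 0 0 + M 1 1) ^+ 2 - (y * u) ^+ 2 - 4 * (y * v) * (y * w)); first by ring.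
by rewrite -a2; ring.
Qed.

Lemma coordsM M N x y x' y' : coords u v w M x y -> coords u v w N x' y' ->
  exists x'' y'', [/\ coords u v w (M * N) x'' y'', 2 * x'' = x * x' + y * y' * D
    & 2 * y'' = x * y' + x' * y].
Proof.
rewrite [M]mx2_eta [N]mx2_eta mx2M /coords !mxE /=.
move: (M 0 0) (M 0 1) (M 1 0) (M 1 1) (N 0 0) (N 0 1) (N 1 0) (N 1 1).
move=> a b c d a' b' c' d' [a1 a2 -> ->] [b1 b2 -> ->].
have ea : a = d + y * u by lia.
have ea' : a' = d' + y' * u by lia.
subst a a'; exists ((d + y * u) * (d' + y' * u) + y * v * (y' * w) + (y * w * (y' * v) + d * d')).
exists ((d + y * u) * y' + d' * y).
by rewrite -a1 -b1 /D; split; [split|..]; ring.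
Qed.

Lemma coordsV M x y : M \is a GRing.unit -> coords u v w M x y ->
  coords u v w M^-1 (\det M * x) (- (\det M * y)).
Proof.
move=> UM; rewrite [M in M^-1]mx2_eta mx2V -?mx2_eta // /coords !mxE /=.
case=> a1 a2 a3 a4; rewrite a3 a4 -a1; split; [ring| | ring | ring].
transitivity (- (\det M * (M 0 0 - M 1 1))); first by ring.
by rewrite a2; ring.
Qed.
End Coords.

(** M commutes with A exactly when (a - d, b, c) is parallel to (p - s, q, r). Dividing the latter
    by its gcd g makes it primitive, and the Bezout coefficients of g yield the integral factor
    y. *)
Lemma commutant_coords (p q r s : int) : [|| p != s, q != 0 | r != 0] ->
  exists g u v w : int, [/\ 0 < g, coords u v w (mx2 p q r s) (p + s) g &
  forall M, mx2 p q r s * M = M * mx2 p q r s -> exists x y, coords u v w M x y].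
Proof.
move=> nz; pose g := gcdz (gcdz (p - s) q) r.
have g0 : 0 < g.
  rewrite lt_neqAle eq_sym andbT /g gcdz_eq0 gcdz_eq0 subr_eq0.
  by rewrite !negb_and -orbA.
have /dvdzP[u eu] : (g %| p - s)%Z by rewrite (dvdz_trans (dvdz_gcdl _ _)) ?dvdz_gcdl.
have /dvdzP[v ev] : (g %| q)%Z by rewrite (dvdz_trans (dvdz_gcdl _ _)) ?dvdz_gcdr.
have /dvdzP[w ew] : (g %| r)%Z by rewrite dvdz_gcdr.
have [l [m eg1]] := Bezoutz (p - s) q; have [l' [n eg2]] := Bezoutz (gcdz (p - s) q) r.
exists g, u, v, w; split=> //; first by rewrite /coords !mxE /=; split; lia.
move=> M; rewrite [M]mx2_eta !mx2M => /mx2_inj.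
rewrite /coords !mxE /=; move: (M 0 0) (M 0 1) (M 1 0) (M 1 1) => a b c d [e1 e2 e3 e4].
exists (a + d), (l' * (l * (a - d) + m * b) + n * c).
have eg : g = l' * (l * (p - s) + m * q) + n * r by rewrite eg1 eg2.
have c1 : q * c = r * b by lia.
have c2 : (p - s) * b = q * (a - d) by lia.
have c3 : (p - s) * c = r * (a - d) by lia.
have gn0 : g != 0 by rewrite gt_eqF.
have key K E : (p - s) * E = K * (a - d) -> q * E = K * b -> r * E = K * c ->
    g * E = K * (l' * (l * (a - d) + m * b) + n * c).
  move=> h1 h2 h3; rewrite {1}eg.
  transitivity (l' * l * ((p - s) * E) + l' * m * (q * E) + n * (r * E)); first by ring.
  by rewrite h1 h2 h3; ring.
split=> //; apply: (mulfI gn0).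
- by rewrite (key (p - s)) // eu; ring.
- by rewrite (key q b c2 erefl (esym c1)) {1}ev; ring.
- by rewrite (key r c c3 c1 erefl) {1}ew; ring.
Qed.

Lemma eqpm_exp_mod (R : pzRingType) (x : R) m n :
  eqpm (x ^+ m) 1 -> eqpm (x ^+ (n %% m)) (x ^+ n).
Proof.
move=> e; rewrite {2}(divn_eq n m) exprD mulnC exprM -{1}[x ^+ _]mul1r.
by apply/eqpm_mul/eqpm_refl; rewrite eqpm_sym -[1](expr1n _ (n %/ m)) eqpm_exp.
Qed.

(* [x y; z -x] anticommutes with [p q; r -p] iff 2px + qz + ry = 0.  Conjugation by an
   elementary matrix decreases |p| as long as pqr <> 0, since then |qr| < 4p^2. *)
Lemma anticommuting_conjugate (p q r : int) : `|p ^+ 2 + q * r| = 1 ->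
  exists x y z, 2 * p * x + q * z + r * y = 0 /\ `|x ^+ 2 + y * z| = 1.
Proof.
have [n] := ubnP `|p|%N; elim: n p q r => // n IH p q r lt_n N.
have [p0|p0] := eqVneq p 0.
  by exists 1, 0, 0; rewrite p0 !mulr0 !mul0r expr1n.
wlog le_rq : q r N / `|r| <= `|q|.
  move=> H; have [le|/ltW le] := lerP `|r| `|q|; first exact: H.
  have [|x [y [z [e1 e2]]]] := H r q _ le; first by rewrite mulrC.
  by exists x, z, y; rewrite [z * y]mulrC -e1; split=> //; ring.
have [r0|r0] := eqVneq r 0.
  have p1 : p ^+ 2 = 1.
    by move: N; rewrite r0 mulr0 addr0 ger0_norm ?sqr_ge0.
  have eq2 := divz_eq q 2; set k := (q %/ 2)%Z in eq2.
  (* For r = 0 the first equation is 2px = -qz: take z = 1 or z = 2 by the parity of q, solve for x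
     using p^2 = 1, and choose y to make x^2 + yz = 1. *)
  have [e|e] : (q %% 2)%Z = 0 \/ (q %% 2)%Z = 1.
    by have := modz_ge0 q (isT : 2 != 0 :> int); have := ltz_mod q (isT : 2 != 0 :> int); lia.
  - exists (- p * k), (1 - k ^+ 2), 1; split.
      transitivity (- (2 * k) * p ^+ 2 + q); first by rewrite r0; ring.
      by rewrite p1 eq2 e; ring.
    rewrite (_ : _ + _ = p ^+ 2 * k ^+ 2 + 1 - k ^+ 2); last by ring.
    by rewrite p1 mul1r addrAC subrr.
  - exists (- p * q), (- 2 * k ^+ 2 - 2 * k), 2; split.
      transitivity (- (2 * q) * p ^+ 2 + 2 * q); first by rewrite r0; ring.
      by rewrite p1; ring.
    rewrite (_ : _ + _ = p ^+ 2 * q ^+ 2 + 2 * (- 2 * k ^+ 2 - 2 * k)); last by ring.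
    by rewrite p1 mul1r eq2 e (_ : _ + _ = 1) //; ring.
(* With this sign |p + e r| is the distance between |p| and |r|, hence less than |p| as 0 < |r| <
   2|p|. *)
pose e : int := if (0 < p) == (0 < r) then - 1 else 1.
have e2 : e ^+ 2 = 1 by rewrite /e; case: ifP.
have ltr : `|r| < 2 * `|p|.
  have l1 : `|q| * `|r| <= `|p| ^+ 2 + 1.
    have : `|q * r| <= `|p ^+ 2| + 1.
      have := ler_normB (p ^+ 2 + q * r) (p ^+ 2); rewrite N addrC addKr.
      by rewrite [1 + _]addrC.
    by rewrite normrM normrX.
  have : `|r| * `|r| <= `|q| * `|r| by rewrite ler_wpM2r.
  have : 1 <= `|p| by lia.
  move: (`|r|) (`|p|) (`|q| * `|r|) l1 => R P Q; nia.
have [||x [y [z [e1 e3]]]] := IH (p + e * r) (q - 2 * e * p - r) r.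
- by rewrite /e; case: ifP; lia.
- rewrite -[RHS]N; congr `|_|.
  transitivity (p ^+ 2 + q * r + (e ^+ 2 - 1) * r ^+ 2); first by ring.
  by rewrite e2; ring.
exists (x - e * z), (y + 2 * e * x - z), z; split.
  rewrite -[RHS]e1; transitivity (2 * (p + e * r) * x + (q - 2 * e * p - r) * z + r * y).
    by ring.
  by [].
rewrite -[RHS]e3; congr `|_|.
transitivity (x ^+ 2 + y * z + (e ^+ 2 - 1) * z ^+ 2); first by ring.
by rewrite e2; ring.
Qed.

(** The two factors |x| - |y| and |x| + |y| have equal parity and a product of absolute value 4, so
    both are 2 in absolute value. *)
Lemma norm_sqr_diff4 (x y : int) : `|x ^+ 2 - y ^+ 2| = 4 -> x = 0 \/ y = 0.
Proof.
rewrite -[x ^+ 2]real_normK ?num_real // -[y ^+ 2]real_normK ?num_real //.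
move=> H; suff : `|x| = 0 \/ `|y| = 0 by case=> /normr0_eq0; [left | right].
move: (`|x|) (`|y|) (normr_ge0 x) (normr_ge0 y) H => {x y} X Y X0 Y0.
wlog le_YX : X Y X0 Y0 / Y <= X.
  move=> W; have [le|/ltW le] := lerP Y X; first exact: W.
  by rewrite distrC => /(W Y X Y0 X0 le)[->|->]; [right | left].
rewrite ger0_norm ?subr_ge0 ?lerXn2r // => H; right.
have [k eX] : exists k, X = Y + k by exists (X - Y); lia.
have k0 : 0 <= k by lia.
have {}H : k * (k + 2 * Y) = 4 by rewrite -H eX; ring.
have [k2|k2] := lerP 2 k; last first.
  have [kk|kk] : k = 0 \/ k = 1 by lia.
    by rewrite kk mul0r in H.
  by rewrite kk in H; lia.
have k4 : k * 2 <= 4 by rewrite -[leRHS]H ler_wpM2l //; lia.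
have {k2 k4} kk : k = 2 by lia.
by rewrite kk in H; lia.
Qed.

Lemma sqr_sum4 (x y : int) : x ^+ 2 + y ^+ 2 = 4 -> x = 0 \/ y = 0.
Proof.
move=> H; have hx : - 2 <= x <= 2 by have := sqr_ge0 y; nia.
have : [|| x == - 2, x == - 1, x == 0, x == 1 | x == 2] by lia.
have Y1 (z : int) : z ^+ 2 = 3 -> False.
  move=> hz; have : - 1 <= z <= 1 by nia.
  move=> hz1; have : [|| z == - 1, z == 0 | z == 1] by lia.
  by case/or3P => /eqP e; rewrite e in hz.
case/or4P => [/eqP e|/eqP e|/eqP e|/orP[]/eqP e]; rewrite e in H *.
- by right; apply/eqP; rewrite -sqrf_eq0; lia.
- by have /Y1 : y ^+ 2 = 3 by lia.
- by left.
- by have /Y1 : y ^+ 2 = 3 by lia.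
- by right; apply/eqP; rewrite -sqrf_eq0; lia.
Qed.

Lemma tr_mx2 (M : 'M[int]_2) : \tr M = M 0 0 + M 1 1.
Proof.
by rewrite /mxtrace !big_ord_recl big_ord0 addr0; congr (_ + M _ _); apply: val_inj.
Qed.

Lemma unit_det (M : 'M[int]_2) : M \is a GRing.unit -> `|\det M| = 1.
Proof. by rewrite [M]mx2_eta unit_mx2 det_mx2 => /eqP. Qed.

(** A = - M A M^-1, and conjugation preserves the trace. So when A has nonzero trace, its
    centralizer modulo sign involves only matrices that truly commute with A. *)
Lemma anticommute_tr (A M : 'M[int]_2) :
  M \is a GRing.unit -> A * M = - (M * A) -> \tr A = 0.
Proof.
move=> UM e; suff : \tr A = - \tr A by lia.
have eA : A = - (M * (A * M^-1)) by rewrite mulrA -mulNr -e mulrK.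
rewrite {1}eA raddfN; congr (- _).
exact: etrans (mxtrace_mulC _ _) (congr1 mxtrace (mulrVK UM A)).
Qed.

Lemma unit_neqN (M : 'M[int]_2) : M \is a GRing.unit -> M <> - M.
Proof.
move=> UM e; have := congr1 (fun N => (N * M^-1) 0 0) e.
by rewrite mulNr mulrV // !mxE.
Qed.

Section Commutant.
Variables u v w : int.
Let D := u ^+ 2 + 4 * v * w.

Lemma coords_norm M x y : M \is a GRing.unit -> coords u v w M x y -> `|x ^+ 2 - y ^+ 2 * D| = 4.
Proof.
by move=> UM C; rewrite (coords_det C) normrM unit_det.
Qed.

Lemma coords_scalar M x : M \is a GRing.unit -> coords u v w M x 0 -> eqpm M 1.
Proof.
move=> UM C; have := coords_norm UM C.
rewrite expr0n mul0r subr0 => n4.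
apply: (coords_eqpm C (coords1 u v w)); rewrite oppr0.
have [e|e] : x = 2 \/ x = - 2; [|by left|by right].
by have := sqr_ge0 x; case: (lerP 0 x) => ?; [left | right]; nia.
Qed.

End Commutant.

Lemma commutant_nonscalar (A : 'M[int]_2) : A \is a GRing.unit -> ~~ eqpm A 1 ->
  exists g u v w : int, [/\ 0 < g, coords u v w A (\tr A) g &
    forall M, A * M = M * A -> exists x y, coords u v w M x y].
Proof.
move=> UA nA; have := @commutant_coords (A 0 0) (A 0 1) (A 1 0) (A 1 1).
rewrite -mx2_eta -tr_mx2; apply; apply: contraR nA.
rewrite !negb_or !negbK => /and3P[/eqP e1 /eqP e2 /eqP e3].
have C : coords 0 0 0 A (\tr A) 0 by rewrite /coords tr_mx2 e1 e2 e3 subrr !mul0r.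
exact: coords_scalar UA C.
Qed.

(** A has coordinates (0, g) with g^2 |D| = 4, so D is one of 4, -4, 1, -1. The norm equation of M
    becomes |X^2 - Y^2| = 4 or X^2 + Y^2 = 4, which forces x = 0 or y = 0. *)
Lemma commutant_tr0 (A M : 'M[int]_2) : A \is a GRing.unit -> \tr A = 0 ->
  M \is a GRing.unit -> A * M = M * A -> eqpm M 1 \/ eqpm M A.
Proof.
move=> UA t0 UM com.
have nA : ~~ eqpm A 1.
  by apply/negP => /eqpmP[] e; move: t0; rewrite e tr_mx2 !mxE.
have [g [u [v [w [g0 CA /(_ M com)[x [y CM]]]]]]] := commutant_nonscalar UA nA.
have NA := coords_norm UA CA; have NM := coords_norm UM CM.
move: NA NM; rewrite t0 expr0n sub0r normrN; set D := _ + _ => NA NM.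
have D0 : D != 0 by apply: contra_eq_neq NA => ->; rewrite mulr0.
have [x0|y0] : x = 0 \/ y = 0.
  have [g1|g2] : g = 1 \/ g = 2.
    have : `|D| >= 1 by lia.
    by move: NA; rewrite normrM normrX; nia.
  - have [e|e] : D = 4 \/ D = - 4 by move: NA; rewrite g1 expr1n mul1r; lia.
    + case: (@norm_sqr_diff4 x (2 * y)); [|by left|by right; lia].
      by rewrite -NM e; congr `|_|; ring.
    + case: (@sqr_sum4 x (2 * y)); [|by left|by right; lia].
      by rewrite -NM e ger0_norm; [ring | nia].
  - have [e|e] : D = 1 \/ D = - 1 by move: NA; rewrite g2; lia.
    + case: (@norm_sqr_diff4 x y); [|by left|by right].
      by rewrite -NM e; congr `|_|; ring.
    + case: (@sqr_sum4 x y); [|by left|by right].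
      by rewrite -NM e ger0_norm; [ring | nia].
- right; apply: (coords_eqpm CM CA); rewrite x0 t0 oppr0.
  suff /eqP : y ^+ 2 = g ^+ 2 by rewrite eqf_sqr => /orP[]/eqP; [left | right].
  move: NM; rewrite x0 expr0n sub0r normrN -NA (normrM (y ^+ 2)) (normrM (g ^+ 2)) => e.
  have D1 : `|D| != 0 by rewrite normr_eq0.
  by have := mulIf D1 e; rewrite !ger0_norm ?sqr_ge0.
- by left; rewrite y0 in CM; apply: coords_scalar CM.
Qed.

Lemma sqr_tr0 (A : 'M[int]_2) : A \is a GRing.unit -> \tr A = 0 -> eqpm (A ^+ 2) 1.
Proof.
move=> UA; have := unit_det UA; rewrite tr_mx2 [A]mx2_eta det_mx2 !mxE /=.
move: (A 0 0) (A 0 1) (A 1 0) (A 1 1) => p q r s n1 t0.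
have es : s = - p by lia.
rewrite es in n1 *; rewrite expr2 mx2M mx2_1 /eqpm mx2N.
have e : p * p + q * r = 1 \/ p * p + q * r = - 1 by lia.
by case: e => e; apply/orP; [left|right]; apply/eqP; congr mx2; lia.
Qed.

Lemma anticommuting_unit (A : 'M[int]_2) : A \is a GRing.unit -> \tr A = 0 ->
  exists2 B : 'M[int]_2, B \is a GRing.unit & A * B = - (B * A).
Proof.
move=> UA; have := unit_det UA; rewrite tr_mx2 [A]mx2_eta det_mx2 !mxE /=.
move: (A 0 0) (A 0 1) (A 1 0) (A 1 1) => p q r s n1 t0.
have es : s = - p by lia.
rewrite es in n1 *.
have [|x [y [z [e1 e2]]]] := @anticommuting_conjugate p q r.
  by rewrite -n1 -[RHS]normrN; congr `|_|; ring.
exists (mx2 x y z (- x)).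
  by rewrite unit_mx2 -e2 -[X in _ == X]normrN; apply/eqP; congr `|_|; ring.
by rewrite !mx2M mx2N; congr mx2; lia.
Qed.

(** * Trace zero: the Klein four-group *)

Section Klein.
Variables A B : 'M[int]_2.
Hypotheses (UA : A \is a GRing.unit) (UB : B \is a GRing.unit).
Hypotheses (A0 : \tr A = 0) (AB : A * B = - (B * A)).

Lemma commute_eqpm_exp (R : pzRingType) (x y : R) i :
  eqpm (x * y) (y * x) -> eqpm (x * y ^+ i) (y ^+ i * x).
Proof.
move=> e; elim: i => [|i IH]; first by rewrite mulr1 mul1r eqpm_refl.
rewrite exprS mulrA; apply: eqpm_trans (eqpm_mul e (eqpm_refl _)) _.
by rewrite -!mulrA eqpm_mul ?eqpm_refl.
Qed.

(** If M anticommutes with A, then M B^-1 commutes with it, so up to sign the centralizer is 1, A,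
    B, AB. Exponents modulo 2 make sense because A^2 and B^2 are 1 up to sign. *)
Lemma pm_isog_klein : pm_isog (symmetry (trace_map A)) ('Z_2 * 'Z_2)%type.
Proof.
have BA : B * A = - (A * B) by rewrite AB opprK.
have B0 : \tr B = 0 by apply: anticommute_tr UA BA.
have BA' : eqpm (B * A) (A * B) by apply/eqpmP; right.
have AB' : eqpm (A * B) (B * A) by rewrite eqpm_sym.
have A2 := sqr_tr0 UA A0; have B2 := sqr_tr0 UB B0.
have no M : M \is a GRing.unit -> M <> - M := @unit_neqN M.
pose psi (a : 'Z_2 * 'Z_2) := A ^+ a.1 * B ^+ a.2.
have A1 : ~~ eqpm A 1.
  by apply/negP => /eqpmP[] e; move: A0; rewrite e tr_mx2 !mxE.
have B1 : ~~ eqpm B 1.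
  by apply/negP => /eqpmP[] e; move: B0; rewrite e tr_mx2 !mxE.
(* If AB were 1 or -1, A would commute with B as well as anticommute. *)
have AnB : ~~ eqpm (A * B) 1.
  apply/negP => /eqpmP e; apply: (no (A * B)); first by rewrite unitr_mul.
  apply: etrans BA; have {e} : A * B * A = A * (A * B).
    by case: e => ->; rewrite ?mulr1 ?mul1r ?mulrN1 ?mulN1r.
  by rewrite -mulrA => /(mulrI UA).
apply: (pm_isog_trace_map (psi := psi)) => //.
- by move=> a; rewrite unitr_mul ?unitrX.
- move=> a b; rewrite /psi /=.
  apply: (@eqpm_trans _ (A ^+ (a.1 + b.1) * B ^+ (a.2 + b.2))).
    by apply: eqpm_mul; apply: eqpm_exp_mod.
  rewrite !exprD -!mulrA; apply: eqpm_mul; first exact: eqpm_refl.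
  rewrite !mulrA; apply: eqpm_mul; last exact: eqpm_refl.
  apply: commute_eqpm_exp; rewrite eqpm_sym; apply: commute_eqpm_exp.
  exact: BA'.
- case=> [[[|[|//]] i] [[|[|//]] j]]; rewrite /psi /= ?expr0 ?expr1 ?mulr1 ?mul1r.
  + by move=> _; congr pair; apply: val_inj.
  + by rewrite (negPf B1).
  + by rewrite (negPf A1).
  + by rewrite (negPf AnB).
- move=> a; rewrite /psi mulrA -exprS exprSr -!mulrA.
  by apply: eqpm_mul; rewrite ?eqpm_refl ?commute_eqpm_exp.
- move=> M UM /eqpmP[com|com].
    case: (commutant_tr0 UA A0 UM com) => e.
      by exists (0, 0); rewrite /psi mulr1.
    by exists (1, 0); rewrite /psi /= mulr1.
  have UMB : M * B^-1 \is a GRing.unit by rewrite unitr_mul ?unitrV.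
  have {}com : A * (M * B^-1) = M * B^-1 * A.
    apply: (mulIr UB); rewrite -!mulrA AB mulVr // mulr1 com mulrN.
    by rewrite mulrN mulKr.
  case: (commutant_tr0 UA A0 UMB com) => /eqpm_mul/(_ (eqpm_refl B)); rewrite mulrVK // => e.
    by exists (0, 1); rewrite /psi /= mul1r -[B ^+ _]/B -[X in eqpm _ X]mul1r.
  by exists (1, 1).
Qed.
End Klein.

Lemma pm_isog_tr0 (A : 'M[int]_2) : A \is a GRing.unit -> \tr A = 0 ->
  pm_isog (symmetry (trace_map A)) ('Z_2 * 'Z_2)%type.
Proof.
by move=> UA A0; have [B UB AB] := anticommuting_unit UA A0; apply: (pm_isog_klein UA UB).
Qed.

(** * Elliptic matrices: discriminant -3 *)

Lemma cayley_hamilton_mx2 (A : 'M[int]_2) : A ^+ 2 = \tr A *: A - (\det A)%:M.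
Proof.
rewrite tr_mx2 [A]mx2_eta det_mx2 expr2 mx2M !mxE /=.
by apply/matrixP => -[[|[|//]] ?] [[|[|//]] ?]; rewrite !mxE /= ?mulr1n ?mulr0n; ring.
Qed.

Lemma elliptic_cube (A : 'M[int]_2) : `|\tr A| = 1 -> \det A = 1 -> eqpm (A ^+ 3) 1.
Proof.
move=> t1 d1; have e := cayley_hamilton_mx2 A; rewrite d1 in e.
have e3 : A ^+ 3 = - (\tr A)%:M.
  rewrite exprS e mulrBr mulr1 -scalerAr -expr2 e scalerBr scalerA.
  have -> : \tr A * \tr A = 1 by lia.
  by rewrite scale1r addrAC subrr sub0r scale_scalar_mx mulr1.
rewrite e3; apply/eqpmP; have [->|->] : \tr A = 1 \/ \tr A = - 1 by lia.
  by right.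
by left; rewrite raddfN opprK.
Qed.

(** The norm equation of A reads g^2 D = -3, so g = 1 and D = -3. The commutant is then the ring of
    Eisenstein integers, whose units solve x^2 + 3y^2 = 4: up to sign they are 1, A and A^2. *)
Lemma pm_isog_elliptic (A : 'M[int]_2) : A \is a GRing.unit ->
  `|\tr A| = 1 -> \det A = 1 -> pm_isog (symmetry (trace_map A)) 'Z_3.
Proof.
move=> UA t1 d1; have A3 := elliptic_cube t1 d1.
have A1 : ~~ eqpm A 1.
  by apply/negP => /eqpmP[] e; move: t1; rewrite e tr_mx2 !mxE.
have [g [u [v [w [g0 CA comm]]]]] := commutant_nonscalar UA A1.
have ND := coords_det CA; rewrite d1 in ND; set D := u ^+ 2 + _ in ND.
have [g1 D3] : g = 1 /\ D = - 3.
  have t2 : (\tr A) ^+ 2 = 1 by rewrite -real_normK ?num_real // t1 expr1n.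
  move: ND t2; move: (\tr A) => t ND t2; have g1 : g = 1.
    have g2 : g ^+ 2 * D = - 3 by clear -ND t2; lia.
    have : D < 0 by nia.
    have [//|g2'] := eqVneq g 1.
    have : 2 <= g by lia.
    nia.
  by split=> //; move: ND; rewrite g1 expr1n mul1r; lia.
have [x2 [y2 [CA2 ex2 ey2]]] := coordsM CA CA; rewrite -/D D3 g1 in ex2 ey2.
have {ex2}ex2 : x2 = - 1 by nia.
have {ey2}ey2 : y2 = \tr A by lia.
rewrite ex2 ey2 -expr2 in CA2; rewrite g1 in CA.
apply: (pm_isog_trace_map (psi := fun k : 'Z_3 => A ^+ k)) => //.
- by move=> k; rewrite unitrX.
- by move=> i j; rewrite -exprD; apply: eqpm_exp_mod.
- case=> [[|[|[|//]]] i] /=; first by move=> _; apply: val_inj.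
    by rewrite expr1 (negPf A1).
  move=> e; case/negP: A1; rewrite eqpm_sym; apply: eqpm_trans (_ : eqpm _ (A ^+ 3)) _.
    by rewrite eqpm_sym.
  by have := eqpm_mul (eqpm_refl A) e; rewrite mulr1 -exprS.
- by move=> k; rewrite -exprS exprSr eqpm_refl.
move=> M UM /eqpmP[/comm[x [y CM]]|/(anticommute_tr UM)]; last by move=> t0; rewrite t0 in t1.
have := coords_norm UM CM; rewrite -/D D3 => n4.
have {n4} n4 : x ^+ 2 + 3 * y ^+ 2 = 4.
  by have := sqr_ge0 x; have := sqr_ge0 y; lia.
have : [|| y == 0, y == 1 | y == - 1] by have := sqr_ge0 x; nia.
have xy : y ^+ 2 = 1 -> x = 1 \/ x = - 1.
  move=> e; have {n4} : x ^+ 2 == 1 ^+ 2 by rewrite e in n4; apply/eqP; lia.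
  by rewrite eqf_sqr => /orP[]/eqP; [left | right].
have key k x' y' : coords u v w (A ^+ k) x' y' ->
    x = x' /\ y = y' \/ x = - x' /\ y = - y' -> eqpm M (A ^+ k).
  exact: coords_eqpm.
(* A has coordinates (tr A, 1) and A^2 has (-1, tr A), so for y nonzero M is A up to sign if xy = tr
   A, and A^2 up to sign if xy = - tr A. *)
have tE : \tr A = 1 \/ \tr A = - 1 by clear -t1; lia.
case/or3P => /eqP ey; first by exists 0; rewrite ey in CM; apply: coords_scalar CM.
- have [|ex|ex] := xy _; first by rewrite ey.
    case: tE => e; rewrite e in CA CA2.
      by exists 1; apply: (key 1%N _ _ CA); left.
    by exists 2; apply: (key 2%N _ _ CA2); right; rewrite ex ey opprK.
  case: tE => e; rewrite e in CA CA2.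
    by exists 2; apply: (key 2%N _ _ CA2); left.
  by exists 1; apply: (key 1%N _ _ CA); left.
- have [|ex|ex] := xy _; first by rewrite ey sqrrN.
    case: tE => e; rewrite e in CA CA2.
      by exists 2; apply: (key 2%N _ _ CA2); right; rewrite opprK.
    by exists 1; apply: (key 1%N _ _ CA); right; rewrite opprK.
  case: tE => e; rewrite e in CA CA2.
    by exists 1; apply: (key 1%N _ _ CA); right.
  by exists 2; apply: (key 2%N _ _ CA2); left.
Qed.

(* For x' = 1 the only possibility is D = 5, y' = 1, the golden ratio. *)
Lemma unit_product_increases (D x y x' y' x'' y'' : int) : 0 <= D ->
    0 < x -> 0 < y -> 0 < x' -> 0 < y' -> `|x' ^+ 2 - y' ^+ 2 * D| = 4 ->
    2 * x'' = x * x' + y * y' * D -> 2 * y'' = x * y' + x' * y ->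
  [/\ 0 < x'', 0 < y'' & x + y < x'' + y''].
Proof.
move=> D0 x0 y0 x0' y0' N ex ey.
have a1 : 0 < x * x' by rewrite mulr_gt0.
have a2 : 0 <= y * y' * D by rewrite !mulr_ge0 // ltW.
have a3 : 0 < x * y' by rewrite mulr_gt0.
have a4 : 0 < x' * y by rewrite mulr_gt0.
split; [by clear -ex a1 a2; lia | by clear -ey a3 a4; lia |].
have [x1|x2] := lerP x' 1; last first.
  have b1 : x * 2 <= x * x' by rewrite ler_wpM2l //; lia.
  have b2 : 2 * y <= x' * y by rewrite ler_wpM2r //; lia.
  by clear -ex ey a2 a3 b1 b2; lia.
have {x1} e1 : x' = 1 by clear -x1 x0'; lia.
rewrite e1 in N ex ey.
have N5 : y' ^+ 2 * D = 5.
  have : 0 <= y' ^+ 2 * D by rewrite mulr_ge0 ?sqr_ge0.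
  by clear -N; lia.
have D1 : 1 <= D by move: D0; rewrite le_eqVlt => /predU1P[d0|//]; rewrite -d0 mulr0 in N5.
have y5 : y' ^+ 2 <= 5 by rewrite -N5 ler_peMr ?sqr_ge0.
have y1 : y' = 1.
  have : y' < 3 by clear -y5 y0'; nia.
  have [//|y2 y3] := eqVneq y' 1; have {y2 y3} y2 : y' = 2 by clear -y0' y2 y3; lia.
  by rewrite y2 in N5; clear -N5; lia.
rewrite y1 in N5 ex ey; have D5 : D = 5 by clear -N5; lia.
by rewrite D5 in ex; clear -ex ey x0 y0; lia.
Qed.

Lemma norm1_int (x : int) : `|x| = 1 -> x = 1 \/ x = - 1.
Proof. by case: (lerP 0 x) => ? ?; [left | right]; lia. Qed.

(** * Units of orders of nonnegative discriminant *)

Section RealQuadraticOrder.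
Variables u v w : int.
Let D := u ^+ 2 + 4 * v * w.
Hypothesis uvw : [|| u != 0, v != 0 | w != 0].
Hypothesis D_ge0 : 0 <= D.
Hypothesis norm4_neq0 : forall x y : int, `|x ^+ 2 - y ^+ 2 * D| = 4 -> x != 0.

(** For D > 0 and M invertible this means that the unit (x + y sqrt D) / 2 exceeds 1. The form in
    coordinates also covers D = 0, where the size of that number no longer sees y. *)
Definition positive (M : 'M[int]_2) : Prop := exists x y,
  [/\ coords u v w M x y, 0 < x & 0 < y].

(** Inversion reverses the sign of xy, and negation changes the signs of x and y together; so if
    neither is zero, one of M, -M, M^-1, -M^-1 is positive. *)
Lemma positive_or_inverse M x y : M \is a GRing.unit -> coords u v w M x y ->
  eqpm M 1 \/ exists N, [/\ N \is a GRing.unit, positive N & eqpm M N \/ eqpm M N^-1].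
Proof.
move=> UM C; have [y0|y0] := eqVneq y 0.
  by left; rewrite y0 in C; apply: coords_scalar C.
right; have x0 := norm4_neq0 (coords_norm UM C).
have key N a b : coords u v w N a b -> 0 < a * b -> positive N \/ positive (- N).
  move=> CN ab; have [a0|a0] := ltrP 0 a.
    by left; exists a, b; rewrite -(pmulr_rgt0 b a0).
  right; exists (- a), (- b); have {}a0 : a < 0.
    by rewrite lt_neqAle a0 andbT; apply: contraTneq ab => ->; rewrite mul0r ltxx.
  by rewrite !oppr_gt0 -(nmulr_rgt0 b a0); split=> //; apply: coordsN.
have [xy|xy] := ltrP 0 (x * y).
  case: (key _ _ _ C xy) => P; [exists M | exists (- M)]; rewrite ?unitrN; split=> //.
    by left; apply: eqpm_refl.
  by left; rewrite /eqpm opprK eqxx orbT.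
have {}xy : x * y < 0 by rewrite lt_neqAle xy mulf_neq0.
have d2 : \det M * \det M = 1 by rewrite -expr2 -real_normK ?num_real // unit_det ?expr1n.
case: (key _ _ _ (coordsV UM C)).
- rewrite (_ : _ * _ = - (\det M * \det M * (x * y))); last by ring.
  by rewrite d2 mul1r oppr_gt0.
- move=> P; exists M^-1; split; rewrite ?unitrV //.
  by right; rewrite invrK eqpm_refl.
- move=> P; exists (- M^-1); split; rewrite ?unitrN ?unitrV //.
  by right; rewrite invrN invrK /eqpm opprK eqxx orbT.
Qed.

Lemma positiveM M N : M \is a GRing.unit -> N \is a GRing.unit ->
  positive M -> positive N -> positive (M * N).
Proof.
move=> UM UN [x [y [CM x0 y0]]] [x' [y' [CN x0' y0']]].
have [x'' [y'' [C e1 e2]]] := coordsM CM CN.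
have [? ? _] := unit_product_increases D_ge0 x0 y0 x0' y0' (coords_norm UN CN) e1 e2.
by exists x'', y''.
Qed.

Lemma positive_neq1 M : positive M -> ~~ eqpm M 1.
Proof.
case=> x [y [C x0 y0]]; apply/negP => /eqpmP e.
have [a Ca] : exists a, coords u v w M a 0.
  by case: e => ->; [exists 2; exact: coords1 | exists (- 2)];
     rewrite -[X in coords _ _ _ _ _ X]oppr0; apply/coordsN/coords1.
have yn : y != 0 by rewrite gt_eqF.
case: Ca => _ d2 d3 d4; case: C => _; rewrite d2 d3 d4 !mul0r.
do 3![move=> /esym/eqP; rewrite mulf_eq0 (negPf yn) /= => /eqP ?].
by move: uvw; subst; rewrite eqxx.
Qed.

Lemma positive_exp G n : G \is a GRing.unit -> positive G -> positive (G ^+ n.+1).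
Proof.
move=> UG PG; elim: n => [|n IH]; first by rewrite expr1.
by rewrite exprS; apply: positiveM; rewrite ?unitrX.
Qed.

Lemma coordsC M N x y x' y' : coords u v w M x y -> coords u v w N x' y' -> M * N = N * M.
Proof.
move=> CM CN; have [a [b [C1 e1 e2]]] := coordsM CM CN.
have [a' [b' [C2 e3 e4]]] := coordsM CN CM.
have ea : a = a' by clear -e1 e3; lia.
have eb : b = b' by clear -e2 e4; lia.
by rewrite ea eb in C1; apply: coords_inj C1 C2.
Qed.

(** Well-ordering through [ex_minn] needs a boolean predicate: [ok] says that x and y are the
    coordinates of an invertible integral matrix, where x + yu even makes the diagonal integral. *)
Lemma positive_minimal M : M \is a GRing.unit -> positive M ->
  exists G x y, [/\ G \is a GRing.unit, coords u v w G x y, 0 < x, 0 < y &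
    forall N x' y', N \is a GRing.unit -> coords u v w N x' y' -> 0 < x' -> 0 < y' ->
      x + y <= x' + y'].
Proof.
pose ok (x y : int) := [&& 0 < x, 0 < y, `|x ^+ 2 - y ^+ 2 * D| == 4 & (2 %| x + y * u)%Z].
have okP x y :
    reflect (exists M, [/\ M \is a GRing.unit, coords u v w M x y, 0 < x & 0 < y]) (ok x y).
  apply: (iffP and4P) => [[x0 y0 /eqP N /dvdzP[k ek]]|[N [UN C x0 y0]]].
    exists (mx2 k (y * v) (y * w) (x - k)).
    have C : coords u v w (mx2 k (y * v) (y * w) (x - k)) x y.
      rewrite /coords !mxE /=; split=> //; [ring | clear -ek; lia].
    split=> //.
    have := coords_det C; rewrite -/D => e; rewrite e normrM in N.
    rewrite unit_mx2 -det_mx2; apply/eqP.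
    clear -N; lia.
  split=> //; first by apply/eqP; apply: coords_norm UN C.
  case: C => e1 e2 _ _; rewrite -e1 -e2; apply/dvdzP; exists (N 0 0); ring.
pose P n := has (fun i : nat => ok i%:Z (n%:Z - i%:Z)) (iota 0 n).
have PI N x y : N \is a GRing.unit -> coords u v w N x y -> 0 < x -> 0 < y -> P (absz (x + y)).
  move=> UN C x0 y0; apply/hasP; exists (absz x); first by rewrite mem_iota; clear -x0 y0; lia.
  have -> : (absz x)%:Z = x by clear -x0; lia.
  have -> : (absz (x + y))%:Z - x = y by clear -x0 y0; lia.
  by apply/okP; exists N.
move=> UM [x [y [C x0 y0]]].
have exP : exists n, P n by exists (absz (x + y)); apply: PI C x0 y0.
case: (ex_minnP exP) => n /hasP[i _ /okP[G [UG CG i0 j0]]] minn.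
exists G, i%:Z, (n%:Z - i%:Z); split=> // N x' y' UN CN x0' y0'.
have := minn _ (PI _ _ _ UN CN x0' y0'); clear -x0' y0'; lia.
Qed.

Lemma coords_eqpm_positive M N x y x' y' : coords u v w M x y -> coords u v w N x' y' ->
  0 < x -> 0 < y -> 0 < x' -> 0 < y' -> eqpm M N -> x = x' /\ y = y'.
Proof.
move=> CM CN x0 y0 x0' y0' /eqpmP[] e; last first.
  have := coordsN CN; rewrite -e => -[e1 _ _ _]; case: CM => e2 _ _ _.
  by move: x0; rewrite -e2 e1 oppr_gt0 ltNge ltW.
rewrite -e in CN; case: CM => m1 m2 m3 m4; case: CN => n1 n2 n3 n4.
split; first by rewrite -m1.
by case/or3P: uvw => z0; apply: (mulIf z0); [rewrite -m2 | rewrite -m3 | rewrite -m4].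
Qed.

(** Let G minimize x + y. For positive M, the quotient M G^-1 is trivial, or positive, or inverse to
    a positive N, up to sign. If positive, it has a smaller sum than M and induction applies; in the
    last case G = M N up to sign has a larger sum than M, against minimality. *)
Lemma fundamental_unit M0 : M0 \is a GRing.unit -> positive M0 ->
  exists G, [/\ G \is a GRing.unit, positive G & forall M x y,
    M \is a GRing.unit -> coords u v w M x y -> exists n : int, eqpm M (G ^ n)].
Proof.
move=> U0 P0; have [G [a [b [UG CG a0 b0 minG]]]] := positive_minimal U0 P0.
have gen n : forall M x y, M \is a GRing.unit -> coords u v w M x y ->
    0 < x -> 0 < y -> x + y < n%:Z -> exists k, eqpm M (G ^+ k).
  elim: n => [|n IH] M x y UM CM x0 y0 lt_n; first by lia.
  have UK : M * G^-1 \is a GRing.unit by rewrite unitr_mul ?unitrV.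
  have [s [t [CK _ _]]] := coordsM CM (coordsV UG CG).
  have [K1|[N [UN [x' [y' [CN x0' y0']]] KN]]] := positive_or_inverse UK CK.
    exists 1%N; have := eqpm_mul K1 (eqpm_refl G); by rewrite mulrVK // mul1r expr1.
  case: KN => /eqpm_mul/(_ (eqpm_refl G)); rewrite mulrVK // => eM.
    have [c [d [C1 e1 e2]]] := coordsM CN CG.
    have [c0 d0 lt1] := unit_product_increases D_ge0 x0' y0' a0 b0 (coords_norm UG CG) e1 e2.
    have [ec ed] := coords_eqpm_positive CM C1 x0 y0 c0 d0 eM.
    have [|k eN] := IH N x' y' UN CN x0' y0'.
      by clear -lt1 lt_n ec ed; lia.
    exists k.+1; rewrite exprSr; apply: eqpm_trans eM _.
    by apply: eqpm_mul eN (eqpm_refl _).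
  have eG : eqpm G (M * N).
    rewrite eqpm_sym (coordsC CM CN); have := eqpm_mul (eqpm_refl N) eM.
    by rewrite mulVKr.
  have [c [d [C1 e1 e2]]] := coordsM CM CN.
  have [c0 d0 lt1] := unit_product_increases D_ge0 x0 y0 x0' y0' (coords_norm UN CN) e1 e2.
  have [ec ed] := coords_eqpm_positive CG C1 a0 b0 c0 d0 eG.
  have := minG _ _ _ UM CM x0 y0; rewrite ec ed; clear -lt1; lia.
exists G; split=> // [|M x y UM CM]; first by exists a, b.
have [M1|[N [UN [x' [y' [CN x0' y0']]] MN]]] := positive_or_inverse UM CM.
  by exists 0.
have [|k eN] := gen (absz (x' + y')).+1 N x' y' UN CN x0' y0'; first by clear; lia.
case: MN => e.
  by exists k%:Z; apply: eqpm_trans e eN.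
exists (- k%:Z); apply: eqpm_trans e _; rewrite -exprz_inv -exprnP exprVn.
have /eqpmP[->|->] := eN; rewrite ?invrN ?eqpm_refl //.
by rewrite eqpm_sym /eqpm opprK eqxx orbT.
Qed.

End RealQuadraticOrder.

Lemma pm_isog_infinite_order (A : 'M[int]_2) : A \is a GRing.unit -> ~~ eqpm A 1 ->
    \tr A != 0 -> ~ (`|\tr A| = 1 /\ \det A = 1) ->
  pm_isog (symmetry (trace_map A)) int.
Proof.
move=> UA A1 t0 nell.
have [g [u [v [w [g0 CA comm]]]]] := commutant_nonscalar UA A1.
have ND := coords_det CA; set D := u ^+ 2 + _ in ND.
have uvw : [|| u != 0, v != 0 | w != 0].
  apply: contraR A1; rewrite !negb_or !negbK => /and3P[/eqP u0 /eqP v0 /eqP w0].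
  have C0 : coords u v w A (\tr A) 0.
    by case: CA => c1 c2 c3 c4; split; rewrite // mul0r ?c2 ?c3 ?c4 ?u0 ?v0 ?w0 mulr0.
  exact: coords_scalar UA C0.
have NA := coords_norm UA CA; rewrite -/D in NA.
have g2 : 1 <= g ^+ 2 by rewrite exprn_ege1.
(* For D < 0 the norm equation gives det A = 1 and (tr A)^2 <= 3, the excluded elliptic case. *)
have D0 : 0 <= D.
  rewrite leNgt; apply/negP => Dn; apply: nell.
  have gD : g ^+ 2 * (- D) >= 1 by rewrite mulr_ege1 //; clear -Dn; lia.
  have t2 := sqr_ge0 (\tr A).
  have d1 : \det A = 1.
    case: (norm1_int (unit_det UA)) => // e; rewrite e in ND.
    by move: ND gD t2; rewrite mulrN; clear; lia.
  rewrite d1 in ND; split=> //; have {t2} : \tr A * \tr A <= 3.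
    by move: ND gD; rewrite mulrN -expr2; clear; lia.
  by move: (\tr A) t0 => t; clear; nia.
(* A unit of trace zero would give y^2 D = 4, so D is 1 or 4 and g^2 D is a nonzero square s^2; then
   |(tr A)^2 - s^2| = 4 forces tr A = 0. *)
have nz x y : `|x ^+ 2 - y ^+ 2 * D| = 4 -> x != 0.
  move=> N; apply: contra_neq t0 => x0; move: N.
  rewrite x0 expr0n sub0r normrN (ger0_norm (mulr_ge0 (sqr_ge0 y) D0)) => yD.
  suff [s [s0 es]] : exists s, s != 0 /\ g ^+ 2 * D = s ^+ 2.
    by rewrite es in NA; have [//|/eqP] := norm_sqr_diff4 NA; rewrite (negPf s0).
  have y0 : y != 0 by apply: contra_eq_neq yD => ->; rewrite expr0n mul0r.
  have D1 : 1 <= D by move: D0; rewrite le_eqVlt => /predU1P[d0|//]; rewrite -d0 mulr0 in yD.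
  have y4 : y ^+ 2 <= 4 by rewrite -yD ler_peMr ?sqr_ge0.
  have y12 : [|| y == 1, y == - 1, y == 2 | y == - 2].
    by have : - 2 <= y <= 2; [clear -y4; nia | clear -y0; lia].
  have [D4|D4] : D = 4 \/ D = 1.
    by case/or4P: y12 => /eqP e; rewrite e in yD; clear -yD; lia.
    exists (2 * g); rewrite mulf_neq0 ?gt_eqF // D4; split=> //; ring.
  by exists g; rewrite gt_eqF // D4 mulr1.
have [|[N [UN PN _]]] := positive_or_inverse nz UA CA; first by rewrite (negPf A1).
have [G [UG PG genG]] := fundamental_unit uvw D0 nz UN PN.
have [x [y [CG _ _]]] := PG.
have AG : A * G = G * A by apply: coordsC CA CG.
apply: (pm_isog_trace_map (psi := fun n : int => G ^ n)) => //.
- by move=> n; rewrite unitrXz.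
- by move=> m n; rewrite exprzDr // eqpm_refl.
- have pos n : ~~ eqpm (G ^+ n.+1) 1.
    exact/(positive_neq1 uvw)/(positive_exp D0 n UG PG).
  case=> [[//|n]|n]; first by rewrite -exprnP (negPf (pos n)).
  rewrite NegzE -exprz_inv -exprnP exprVn => e; case/negP: (pos n).
  have := eqpm_mul (eqpm_refl (G ^+ n.+1)) e.
  by rewrite mulrV ?unitrX // mulr1 eqpm_sym.
- by move=> n; rewrite (commrXz n AG) eqpm_refl.
- move=> M UM /eqpmP[/comm[x' [y' CM]]|/(anticommute_tr UM)/eqP]; last by rewrite (negPf t0).
  exact: genG CM.
Qed.

(** * Recovering the order of F from its symmetry group *)

Lemma symmetry_self F : F \in nielsen -> F \in symmetry F.
Proof. by move=> FN; rewrite inE FN eqxx. Qed.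

Lemma symmetry_id : symmetry pm_id =i nielsen.
Proof. by move=> S; rewrite inE pm_comp_id pm_id_comp eqxx andbT. Qed.

(** Two elementary matrices that do not commute even up to sign. This separates the symmetry group
    of the identity from all the abelian types. *)
Lemma nielsen_nonabelian : exists F G,
  [/\ F \in nielsen, G \in nielsen & pm_comp F G <> pm_comp G F].
Proof.
pose X := mx2 1 1 0 1; pose Y := mx2 1 0 1 1.
have UX : X \is a GRing.unit by rewrite unit_mx2.
have UY : Y \is a GRing.unit by rewrite unit_mx2.
exists (trace_map X), (trace_map Y); split; try by have [] := trace_mapP (_ : _ \is a GRing.unit).
- by have [] := trace_mapP UX.
- by have [] := trace_mapP UY.
rewrite -!trace_mapM // => /trace_map_eq; rewrite !unitr_mul // => /(_ isT isT).
by rewrite !mx2M mx2N => -[] /mx2_inj[].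
Qed.

Section Isog.
Variables (F : polymap) (Z : zmodType).
Hypotheses (FN : F \in nielsen) (iso : pm_isog (symmetry F) Z).

Lemma pm_isog_comm S T : S \in symmetry F -> T \in symmetry F -> pm_comp S T = pm_comp T S.
Proof.
have [phi [_ surj morph]] := iso.
by move=> /surj[a <-] /surj[b <-]; rewrite -!morph addrC.
Qed.

Lemma pm_isog_neq_id : F <> pm_id.
Proof.
move=> Fid; have [X [Y [XN YN]]] := nielsen_nonabelian; case.
by apply: pm_isog_comm; rewrite Fid symmetry_id.
Qed.

(** F belongs to its own symmetry group; the element a matching it has the same order as F. *)
Lemma pm_isog_iter : exists2 a : Z, a <> 0 & forall n, pm_iter n F = pm_id <-> a *+ n = 0.
Proof.
have [phi [inj surj morph]] := iso.
have [a ea] : exists a, phi a = F by apply/surj/symmetry_self.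
have phi0 : phi 0 = pm_id.
  have [e ee] : exists e, phi e = pm_id.
    by apply/surj; rewrite inE nielsen_id pm_comp_id pm_id_comp eqxx.
  have := morph e e; rewrite ee pm_comp_id -ee => /inj/eqP.
  by rewrite -subr_eq0 addrK => /eqP <-.
have iter n : pm_iter n F = phi (a *+ n).
  elim: n => [|n IH]; first by rewrite phi0.
  by rewrite /pm_iter iterS -/(pm_iter _ _) IH mulrS morph ea.
exists a => [a0|n]; first by apply: pm_isog_neq_id; rewrite -ea a0.
by rewrite iter -phi0; split=> [/inj|->].
Qed.

End Isog.

Lemma symmetry_classification F : F \in nielsen ->
  [\/ F = pm_id, pm_isog (symmetry F) ('Z_2 * 'Z_2)%type,
      pm_isog (symmetry F) 'Z_3 | pm_isog (symmetry F) int].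
Proof.
case/trace_map_surj => A UA ->.
have [A1|A1] := boolP (eqpm A 1).
  by apply: Or41; rewrite -trace_map1; apply/trace_map_eq; rewrite ?unitr1 //; apply/eqpmP.
have [t0|t0] := eqVneq (\tr A) 0; first by apply/Or42/pm_isog_tr0.
have [/andP[/eqP t1 /eqP d1]|ell] := boolP ((`|\tr A| == 1) && (\det A == 1)).
  exact/Or43/pm_isog_elliptic.
apply/Or44/pm_isog_infinite_order => // -[t1 d1].
by rewrite t1 d1 !eqxx in ell.
Qed.

Theorem theorem1 (F : polymap) (hF : F \in nielsen) :
  [/\ (symmetry F =i nielsen <-> F = pm_id),
      (pm_isog (symmetry F) ('Z_2 * 'Z_2)%type <->
         pm_iter 2 F = pm_id /\ F <> pm_id),
      (pm_isog (symmetry F) 'Z_3 <->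
         pm_iter 3 F = pm_id /\ F <> pm_id)
    & ((~ [\/ F = pm_id, pm_iter 2 F = pm_id | pm_iter 3 F = pm_id]
          <-> ~ finite_order F)
       /\ (~ finite_order F -> pm_isog (symmetry F) int))].
Proof.
(* Each isomorphism type decides which of the powers 2 and 3 of F are trivial. The cases of the
   classification thus exclude one another, and each implication can be reversed. *)
have Z2 : pm_isog (symmetry F) ('Z_2 * 'Z_2)%type -> pm_iter 2 F = pm_id /\ pm_iter 3 F <> pm_id.
  move=> iso; have [a a0 it] := pm_isog_iter hF iso.
  have a2 : a *+ 2 = 0 by case: a {a0 it} => -[[|[|//]] i] [[|[|//]] j]; congr pair; apply: val_inj.
  by split; [exact/it | move/it; rewrite mulrSr a2 add0r].
have Z3 : pm_isog (symmetry F) 'Z_3 -> pm_iter 3 F = pm_id /\ pm_iter 2 F <> pm_id.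
  move=> iso; have [a a0 it] := pm_isog_iter hF iso.
  have a3 : a *+ 3 = 0 by case: a {a0 it} => -[|[|[|//]]] i; apply: val_inj.
  by split; [exact/it | move/it => a2; apply: a0; rewrite mulrSr a2 add0r in a3].
have Zi n : pm_isog (symmetry F) int -> pm_iter n.+1 F <> pm_id.
  move=> iso; have [a a0 it] := pm_isog_iter hF iso.
  by move/it/eqP; rewrite mulrn_eq0 => /eqP.
have n1 : F = pm_id -> pm_iter 1 F = pm_id.
  by move=> ->; rewrite /pm_iter /= pm_comp_id.
split.
- split=> [e|->]; last exact: symmetry_id.
  have nab Z : pm_isog (symmetry F) Z -> F = pm_id.
    have [X [Y [XN YN nXY]]] := nielsen_nonabelian => iso; case: nXY.
    by apply: (pm_isog_comm iso); rewrite e.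
  by have [//|/nab|/nab|/nab] := symmetry_classification hF.
- split=> [iso|[F2 F1]]; first by split; [have [] := Z2 iso | exact: pm_isog_neq_id iso].
  by have [/F1|//|/Z3[_ /(_ F2)]|/(Zi 1%N)/(_ F2)] := symmetry_classification hF.
- split=> [iso|[F3 F1]]; first by split; [have [] := Z3 iso | exact: pm_isog_neq_id iso].
  by have [/F1|/Z2[_ /(_ F3)]|//|/(Zi 2%N)/(_ F3)] := symmetry_classification hF.
split; last first.
  move=> inf; have [F1|/Z2[F2 _]|/Z3[F3 _]|//] := symmetry_classification hF; case: inf.
  - by exists 1%N; split=> //; apply: n1.
  - by exists 2%N.
  - by exists 3%N.
split=> [small [n [n0 Fn]]|inf]; last first.
  by case=> [F1|F2|F3]; apply: inf; [exists 1%N; split=> //; apply: n1 | exists 2%N | exists 3%N].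
apply: small; have [F1|/Z2[F2 _]|/Z3[F3 _]|iso] := symmetry_classification hF.
- exact: Or31.
- exact: Or32.
- exact: Or33.
- by case: n n0 Fn => // n _ /Zi-/(_ iso).
Qed.
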